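(* Let $G$ be a finite, compact metric graph with edges $I_1,\dots,I_r$ of lengths $L_1,\dots,L_r$ and vertices $v_1,\dots,v_s$, and let $B$ be a set of vertices of $G$ which contains all boundary vertices and all proper core vertices of $G$. Moreover, let $\mathcal{L}$ be the Laplacian on $G$, i.e., $(\mathcal{L}f)_j=-f_j''$ on $I_j$, $j=1,\dots,r$. Let $\alpha\in\mathbb{R}^s$, let $A_\alpha$ be the corresponding selfadjoint operator in $L^2(G)$ with $\delta$-type vertex conditions of strength $\alpha$, and let $M_{B,\alpha}$ be the corresponding Titchmarsh--Weyl function. Assume that each cycle in $G$ contains two edges with rationally independent edge lengths. Then the following assertions hold for each $\lambda\in\mathbb{R}$. (i) $\lambda$ is an eigenvalue of $A_\alpha$ if and only if $\lambda$ is a pole of $M_{B,\alpha}$. (ii) $\dim\ker(A_\alpha-\lambda)=\operatorname{rank}\operatorname{Res}_\lambda M_{B,\alpha}$.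
   Context: A finite, compact metric graph $G$ is a collection of finitely many compact intervals $I_j=[0,L_j]$, $L_j>0$, $j=1,\dots,r$ (the edges), together with an equivalence relation on the set of endpoints of these intervals; the equivalence classes $v_1,\dots,v_s$ are the vertices. Write $o(I_j)$ for the vertex containing the endpoint $0$ of $I_j$ and $t(I_j)$ for the vertex containing the endpoint $L_j$. Loops and multiple edges are allowed. The degree of a vertex is the cardinality of the equivalence class (a loop counts twice). A boundary vertex is a vertex of degree one. The core of $G$ is the largest subgraph of $G$ (consisting of a set of edges together with their endpoints) which does not have vertices of degree one (degrees being taken in the subgraph); it is empty if and only if every connected component of $G$ is a tree. A vertex $v$ of $G$ is called a proper core vertex if all edges attached to $v$ belong to the core of $G$. A cycle in $G$ is a closed path in $G$ without repeated edges or vertices (apart from the coinciding start and end vertex); a loop is a cycle with one edge and two parallel edges form a cycle with two edges. Two lengths $L_j,L_k$ are rationally independent if $L_j/L_k\notin\mathbb{Q}$. A function $f:G\to\mathbb{C}$ is a collection of functions $f_j:I_j\to\mathbb{C}$, $j=1,\dots,r$, and $L^2(G)=\bigoplus_{j=1}^r L^2(I_j)$. The function $f$ is continuous on $G$ if each $f_j$ is continuous on $I_j$ and, at each vertex, the values of all components at the endpoints belonging to this vertex coincide; $f(v_i)$ denotes this common value. $AC^2(G)$ is the set of $f:G\to\mathbb{C}$ such that $f_j$ and $f_j'$ are absolutely continuous on $(0,L_j)$ for all $j$ (so that the values of $f_j,f_j'$ at $0$ and $L_j$ are defined). For a vertex $v_i$, $$\partial_\nu f(v_i)=\sum_{t(I_j)=v_i}f_j'(L_j)-\sum_{o(I_j)=v_i}f_j'(0).$$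 The operator $A_\alpha$ in $L^2(G)$ is given by $A_\alpha f=\mathcal{L}f$ with domain consisting of all $f\in L^2(G)\cap AC^2(G)$ such that $\mathcal{L}f\in L^2(G)$, $f$ is continuous on $G$, and $\partial_\nu f(v_i)-\alpha_if(v_i)=0$ for $i=1,\dots,s$. It is selfadjoint, semibounded below, and has compact resolvent; $\sigma(A_\alpha)$ denotes its spectrum, which consists of isolated eigenvalues of finite multiplicity. Titchmarsh--Weyl function: let $B=\{v_{i_1},\dots,v_{i_m}\}$ be a nonempty set of (distinct) vertices and $\mu\in\mathbb{C}\setminus\sigma(A_\alpha)$. For $l=1,\dots,m$ let $f^{(l)}\in L^2(G)\cap AC^2(G)$ be the unique function that is continuous on $G$, satisfies $\mathcal{L}f^{(l)}=\mu f^{(l)}$, $\partial_\nu f^{(l)}(v_{i_l})-\alpha_{i_l}f^{(l)}(v_{i_l})=1$, and $\partial_\nu f^{(l)}(v_i)-\alpha_if^{(l)}(v_i)=0$ for all $i\in\{1,\dots,s\}$ with $i\neq i_l$. Then $M_{B,\alpha}(\mu)\in\mathbb{C}^{m\times m}$ is the matrix with entries $(M_{B,\alpha}(\mu))_{k,l}=f^{(l)}(v_{i_k})$, $k,l=1,\dots,m$. Equivalently, $M_{B,\alpha}(\mu)$ maps $(\partial_\nu f(v_{i_k})-\alpha_{i_k}f(v_{i_k}))_{k=1}^m$ to $(f(v_{i_k}))_{k=1}^m$ for every continuous $f\in L^2(G)\cap AC^2(G)$ with $\mathcal{L}f=\mu f$ and $\partial_\nu f(v_i)-\alpha_if(v_i)=0$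 for all $i\notin\{i_1,\dots,i_m\}$. (A set $B$ containing all boundary vertices and all proper core vertices is automatically nonempty.) The function $M_{B,\alpha}$ is analytic on $\mathbb{C}\setminus\sigma(A_\alpha)$ and meromorphic on $\mathbb{C}$; ''pole'' means a non-removable singularity. $\operatorname{Res}_\lambda M_{B,\alpha}$ is the residue (an $m\times m$ matrix) of $M_{B,\alpha}$ at $\lambda$, with the convention $\operatorname{Res}_\lambda M_{B,\alpha}=0$ if $M_{B,\alpha}$ is analytic at $\lambda$ or can be continued analytically into $\lambda$. *)

(* Defs.v *)
From HB Require Import structures.
From mathcomp Require Import all_boot all_order all_algebra.
From mathcomp Require Import all_classical all_reals all_analysis.
From mathcomp Require Import complex.

Set Implicit Arguments.
Unset Strict Implicit.
Unset Printing Implicit Defensive.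

Import Order.TTheory GRing.Theory Num.Theory numFieldNormedType.Exports.

Local Open Scope classical_set_scope.
Local Open Scope ring_scope.
Local Open Scope complex_scope.

(* MathComp-Analysis topologizes every (abstract) numClosedFieldType by its
   norm; the same structures are made available on the concrete type R[i]. *)
#[non_forgetful_inheritance]
HB.instance Definition _ (R : realType) :=
  PseudoPointedMetric.copy R[i] (R[i])^o.
#[non_forgetful_inheritance]
HB.instance Definition _ (R : realType) := NormedModule.copy R[i] (R[i])^o.

(* The endpoints of the edges are the pairs (j, b), where (j, false) is the
   endpoint 0 and (j, true) is the endpoint L_j of I_j = [0, L_j].  An
   equivalence relation on endpoints with classes v_1, ..., v_s is given by the
   surjection mapping each endpoint to its class. *)
Record metric_graph (R : realType) (r s : nat) := MetricGraph {
  len : 'I_r -> R;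
  len_gt0 : forall j, 0 < len j;
  vert : 'I_r * bool -> 'I_s;
  vert_surj : forall v, exists p, vert p = v
}.

Section Combinatorics.
Context {R : realType} {r s : nat} (G : metric_graph R r s).

(* Degree of v in the subgraph with edge set F. *)
Definition degree_in (F : {set 'I_r}) (v : 'I_s) : nat :=
  #|[set p : 'I_r * bool | (p.1 \in F) && (vert G p == v)]%SET|.

Definition degree (v : 'I_s) : nat := degree_in [set: 'I_r] v.

Definition boundary_vertex (v : 'I_s) : bool := degree v == 1%N.

Definition no_degree_one (F : {set 'I_r}) : bool :=
  [forall v, degree_in F v != 1%N].

(* The edge set of the core, as the union of all edge sets without vertices of
   degree one; by [core_no_degree_one] and [sub_core] it is the largest one. *)
Definition core : {set 'I_r} :=
  (\bigcup_(F : {set 'I_r} | no_degree_one F) F)%SET.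

Lemma core_no_degree_one : no_degree_one core.
Proof.
apply/forallP => v; apply/negP; rewrite /degree_in => /cards1P[p cp].
have {}cp q : (q.1 \in core) && (vert G q == v) = (q == p).
  by have /finset.setP/(_ q) := cp; rewrite !finset.inE.
have := cp p; rewrite eqxx => /andP[/bigcupP[F nF pF] pv].
have /forallP/(_ v)/negP := nF; apply; apply/cards1P; exists p.
apply/finset.setP => q; rewrite !finset.inE.
apply/idP/idP => [/andP[qF qv]|/eqP ->].
  by rewrite -cp qv andbT; apply/bigcupP; exists F.
by rewrite pF pv.
Qed.

Lemma sub_core (F : {set 'I_r}) : no_degree_one F -> F \subset core.
Proof. by move=> nF; exact: (finset.bigcup_sup F). Qed.

Definition proper_core_vertex (v : 'I_s) : bool :=
  [forall p : 'I_r * bool, (vert G p == v) ==> (p.1 \in core)].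

(* A pair d = (j, b) also denotes the edge I_j traversed starting from its
   endpoint d. *)
Definition source (d : 'I_r * bool) : 'I_s := vert G d.
Definition target (d : 'I_r * bool) : 'I_s := vert G (d.1, ~~ d.2).

Definition is_cycle (c : seq ('I_r * bool)) : bool :=
  [&& c != [::], cycle [rel d d' | target d == source d'] c,
      uniq [seq d.1 | d <- c] & uniq [seq source d | d <- c]].

End Combinatorics.

Definition rationally_independent (R : realType) (x y : R) : Prop :=
  ~ exists q : rat, x / y = ratr q.

Section RealToComplex.
Context {R : realType}.
Implicit Types (f : R -> R[i]) (x : R).

Definition is_cderive f x (d : R[i]) : Prop :=
  is_derive x 1 (fun t => complex.Re (f t)) (complex.Re d) /\
  is_derive x 1 (fun t => complex.Im (f t)) (complex.Im d).

Definition cderivable f x : Prop := exists d, is_cderive f x d.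

Definition cderive f : R -> R[i] := fun x =>
  derive1 (fun t => complex.Re (f t)) x +i* derive1 (fun t => complex.Im (f t)) x.

(* Absolute continuity on the open interval ]a, b[; the intervals
   ](I i).1, (I i).2[ range over finite disjoint families. *)
Definition abs_continuous f (a b : R) : Prop :=
  forall e : R, 0 < e -> exists2 d : R, 0 < d &
    forall (n : nat) (I : 'I_n -> R * R),
      (forall i, a < (I i).1 /\ (I i).1 <= (I i).2 /\ (I i).2 < b) ->
      (forall i k, i != k -> (I i).2 <= (I k).1 \/ (I k).2 <= (I i).1) ->
      \sum_i ((I i).2 - (I i).1) < d ->
      \sum_i ComplexField.Normc.normc (f (I i).2 - f (I i).1) < e.

Definition square_integrable f (D : set R) : Prop :=
  [/\ measurable_fun D (fun x => complex.Re (f x)),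
      measurable_fun D (fun x => complex.Im (f x)) &
      (\int[lebesgue_measure]_(x in D)
         ((ComplexField.Normc.normc (f x)) ^+ 2)%:E < +oo)%E].

End RealToComplex.

Section Operator.
Context {R : realType} {r s : nat} (G : metric_graph R r s).

(* Only the values of the component f j on [0, L_j] are relevant. *)
Definition gfun := 'I_r -> R -> R[i].
Implicit Types f g : gfun.

Definition gL2 f : Prop := forall j, square_integrable (f j) `[0, len G j].

(* Equality in L^2(G). *)
Definition gae_eq f g : Prop := forall j,
  {ae lebesgue_measure, forall x, x \in `[0, len G j] -> f j x = g j x}.

Definition AC2 f : Prop := forall j,
  [/\ abs_continuous (f j) 0 (len G j),
      (forall x, x \in `]0, len G j[ -> cderivable (f j) x) &
      abs_continuous (cderive (f j)) 0 (len G j)].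

Definition end_value f (p : 'I_r * bool) : R[i] :=
  f p.1 (if p.2 then len G p.1 else 0).

Definition gcontinuous f : Prop :=
  (forall j, {within `[0, len G j], continuous (f j)}) /\
  (forall p q, vert G p = vert G q -> end_value f p = end_value f q).

(* f(v), read off at some endpoint belonging to v; for f continuous on G it
   does not depend on the endpoint. *)
Definition vertex_value f (v : 'I_s) : R[i] :=
  if [pick p | vert G p == v] is Some p then end_value f p else 0.

(* f_j'(0) and f_j'(L_j), as limits of the absolutely continuous function f_j'
   on ]0, L_j[. *)
Definition deriv_left f (j : 'I_r) : R[i] :=
  lim (cderive (f j) x @[x --> 0^'+]).
Definition deriv_right f (j : 'I_r) : R[i] :=
  lim (cderive (f j) x @[x --> (len G j)^'-]).

Definition dnu f (v : 'I_s) : R[i] :=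
  \sum_(j | vert G (j, true) == v) deriv_right f j -
  \sum_(j | vert G (j, false) == v) deriv_left f j.

Variable alpha : 'I_s -> R.

Definition delta_defect f (v : 'I_s) : R[i] :=
  dnu f v - (alpha v)%:C * vertex_value f v.

(* L f = g almost everywhere, where L f = - f''. *)
Definition Laplacian f g : Prop := forall j,
  {ae lebesgue_measure, forall x, x \in `]0, len G j[ ->
    is_cderive (cderive (f j)) x (- g j x)}.

Definition dom_A f : Prop :=
  [/\ gL2 f /\ AC2 f, exists2 g, gL2 g & Laplacian f g,
      gcontinuous f & forall v, delta_defect f v = 0].

Definition ker_A (mu : R[i]) : set gfun :=
  [set f | dom_A f /\ Laplacian f (fun j x => mu * f j x)].

Definition eigenvalue_A (mu : R[i]) : Prop :=
  exists2 f, ker_A mu f & ~ gae_eq f (fun _ _ => 0).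

(* Linear independence and spanning are taken in L^2(G), i.e. almost everywhere. *)
Definition has_dim (V : set gfun) (d : nat) : Prop :=
  exists b : 'I_d -> gfun,
    [/\ forall i, V (b i),
        forall c : 'I_d -> R[i],
          gae_eq (fun j x => \sum_i c i * b i j x) (fun _ _ => 0) ->
          forall i, c i = 0 &
        forall f, V f -> exists c : 'I_d -> R[i],
          gae_eq f (fun j x => \sum_i c i * b i j x)].

Variable B : {set 'I_s}.

Definition TW_solution (mu : R[i]) (l : 'I_#|B|) : set gfun :=
  [set f | [/\ gL2 f /\ AC2 f, gcontinuous f,
               Laplacian f (fun j x => mu * f j x) &
               forall v, delta_defect f v = (v == enum_val l)%:R]].

(* For mu outside the spectrum of A_alpha the solution is unique up to equality
   on G.  On the (discrete) spectrum the value is irrelevant: poles and residues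
   below only depend on punctured neighborhoods. *)
Definition TW (mu : R[i]) : 'M[R[i]]_#|B| :=
  \matrix_(k, l)
    vertex_value (xget (fun _ _ => 0) (TW_solution mu l)) (enum_val k).

End Operator.

Section Singularities.
Context {R : realType} {m : nat}.
Implicit Types (M h : R[i] -> 'M[R[i]]_m) (z : R[i]).

Definition mx_cdiff M z : Prop :=
  forall k l, derivable (fun w : R[i] => M w k l) z 1.

Definition analytic_at M z : Prop := \forall w \near z, mx_cdiff M w.

Definition isolated_singularity M z : Prop := \forall w \near z^', mx_cdiff M w.

(* This includes the case that M itself is analytic at z. *)
Definition removable M z : Prop :=
  exists2 h, analytic_at h z & \forall w \near z^', M w = h w.

Definition is_pole M z : Prop := isolated_singularity M z /\ ~ removable M z.

(* A is the coefficient of (w - z)^-1 in the Laurent expansion of M at z, with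
   (finite) principal part \sum_k (w - z)^-(k+1) c_k; it is 0 if the singularity
   is removable. *)
Definition is_residue M z (A : 'M[R[i]]_m) : Prop :=
  exists (n : nat) (c : nat -> 'M[R[i]]_m) (h : R[i] -> 'M[R[i]]_m),
    [/\ analytic_at h z, c 0%N = A &
        \forall w \near z^',
          M w = \sum_(k < n.+1) (w - z) ^- k.+1 *: c k + h w].

Definition residue M z : 'M[R[i]]_m := xget 0 (is_residue M z).

End Singularities.

(* Main.v *)
Require Import Defs.
From mathcomp Require Import all_boot all_order all_algebra.
From mathcomp Require Import all_classical all_reals all_analysis.
From mathcomp Require Import measurable_realfun complex ring lra zify.

(** Near a real number lambda everything reduces to a square matrix T(w), analytic
    in w.  On an edge, a solution of - f'' = w f is determined by its Cauchy data at
    the initial end, and T(w) is the matrix of the linear system, in these data and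
    the vertex values, which expresses continuity and the vertex conditions.  Its
    kernel at w = lambda is the kernel of A_alpha - lambda, and the Titchmarsh-Weyl
    matrix is the transpose of the block of T(w)^-1 with row and column indices
    in B ([TW_inverse]).

    Selfadjointness excludes Jordan chains of T at lambda ([no_jordan_chain]).
    Therefore T(w)^-1 = (w - lambda)^-1 A + h(w) with h analytic at lambda and
    rank A equal to the dimension of the kernel ([simple_pole_inverse]); moreover
    A T(lambda) = T(lambda) A = 0.  So the residue of the Weyl matrix is the
    transpose of a block of A, and it remains to see that this block has the rank
    of A.

    The rows of A lie in the left kernel of T(lambda), that is, they are
    eigenfunctions.  An eigenfunction that vanishes on B is zero
    ([unique_continuation]): its support has no vertex of degree one, so it lies in
    the core, and it vanishes at all vertices.  If the support were nonempty it would
    contain a cycle ([exists_cycle]), on each edge of which the function is a sine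
    vanishing at both ends; then the lengths of the edges of the cycle would be
    integer multiples of pi / sqrt(lambda), hence pairwise commensurable.  The columns
    of A lie in the right kernel, which by the Lagrange identity is also made
    of eigenfunctions ([right_kernel]).  So restriction to B loses no rank, on
    either side.

    Two analytic points need care.  The definition of a solution only asks for an
    absolutely continuous derivative and for the equation almost everywhere;
    [abs_continuous_cst] shows that such a solution is classical.  Analyticity in w
    rests on power series and their divided differences ([divdiffE]): an entire
    function can be divided by w - z after subtracting its value at z, which gives
    derivatives and polar parts without contour integrals. *)

Set Implicit Arguments.
Unset Strict Implicit.
Unset Printing Implicit Defensive.

Import Order.TTheory GRing.Theory Num.Theory numFieldNormedType.Exports.
Import ComplexField.Normc.

Local Open Scope classical_set_scope.
Local Open Scope ring_scope.
Local Open Scope complex_scope.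

(** * Modulus and topology of the complex numbers *)

Section ComplexModulus.
Context {R : realType}.
Local Notation C := R[i].
Implicit Types (z w : C).

Lemma norm_normc z : `|z| = (normc z)%:C.
Proof. by []. Qed.

Lemma normc_ge0 z : 0 <= normc z.
Proof. by rewrite -ler0c -norm_normc. Qed.

Lemma normc_le0 z : (normc z <= 0) = (z == 0).
Proof. by rewrite -(lecR _ 0) -norm_normc normr_le0. Qed.

Lemma normc_gt0 z : (0 < normc z) = (z != 0).
Proof. by rewrite -(ltcR 0) -norm_normc normr_gt0. Qed.

Lemma normcX z n : normc (z ^+ n) = normc z ^+ n.
Proof. by elim: n => [|n IH]; rewrite ?normc1// !exprS normcM IH. Qed.

Lemma normcR (x : R) : normc x%:C = `|x|.
Proof. by rewrite /= expr0n/= addr0 sqrtr_sqr. Qed.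

Lemma distcC z w : normc (z - w) = normc (w - z).
Proof. by rewrite -normcN opprB. Qed.

Lemma le_normcB z w : normc (z - w) <= normc z + normc w.
Proof. by rewrite -(normcN w) le_normcD. Qed.

Lemma normRe_le z : `|complex.Re z| <= normc z.
Proof.
case: z => a b /=; rewrite -(sqrtr_sqr a) ler_sqrt ?lerDl ?sqr_ge0//.
by rewrite addr_ge0 ?sqr_ge0.
Qed.

Lemma normIm_le z : `|complex.Im z| <= normc z.
Proof.
case: z => a b /=; rewrite -(sqrtr_sqr b) ler_sqrt ?lerDr ?sqr_ge0//.
by rewrite addr_ge0 ?sqr_ge0.
Qed.

Lemma normc_leReIm z : normc z <= `|complex.Re z| + `|complex.Im z|.
Proof.
case: z => a b /=; rewrite -[leRHS]ger0_norm ?addr_ge0// -[leRHS]sqrtr_sqr.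
rewrite ler_sqrt ?sqr_ge0// -(real_normK (num_real a)) -(real_normK (num_real b)).
by rewrite sqrrD addrAC lerDl mulrn_wge0// mulr_ge0.
Qed.

Lemma ReB z w : complex.Re (z - w) = complex.Re z - complex.Re w.
Proof. by case: z w => a b []. Qed.

Lemma ImB z w : complex.Im (z - w) = complex.Im z - complex.Im w.
Proof. by case: z w => a b []. Qed.

Lemma ReD z w : complex.Re (z + w) = complex.Re z + complex.Re w.
Proof. by case: z w => a b []. Qed.

Lemma ImD z w : complex.Im (z + w) = complex.Im z + complex.Im w.
Proof. by case: z w => a b []. Qed.

Lemma ReM z w : complex.Re (z * w)
  = complex.Re z * complex.Re w - complex.Im z * complex.Im w.
Proof. by case: z w => a b []. Qed.

Lemma ImM z w : complex.Im (z * w)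
  = complex.Re z * complex.Im w + complex.Im z * complex.Re w.
Proof. by case: z w => a b []. Qed.

Lemma complex_ext z w : complex.Re z = complex.Re w ->
  complex.Im z = complex.Im w -> z = w.
Proof. by case: z w => a b [c d] /= -> ->. Qed.

Lemma cball_ex (e : C) : 0 < e -> exists2 d : R, 0 < d & e = d%:C.
Proof.
case: e => a b; rewrite ltcE /= => /andP[/eqP -> a0]; exists a => //.
Qed.

Lemma nearcP z (P : set C) : (\forall w \near z, P w) <->
  exists2 e : R, 0 < e & forall w, normc (w - z) < e -> P w.
Proof.
split=> [/nbhs_ballP[e /cball_ex[d d0 ->] H]|[e e0 H]].
  exists d => // w wz; apply: H; rewrite -ball_normE /ball_/=.
  by rewrite norm_normc ltcR distcC.
apply/nbhs_ballP; exists e%:C; first by rewrite /= ltcR.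
move=> w; rewrite -ball_normE /ball_/= norm_normc ltcR distcC; exact: H.
Qed.

Lemma near_dnbhs_cP z (P : set C) : (\forall w \near z^', P w) <->
  exists2 e : R, 0 < e & forall w, normc (w - z) < e -> w != z -> P w.
Proof.
rewrite /= near_withinE; exact: nearcP.
Qed.

Lemma continuous_cP (F : C -> C) z : {for z, continuous F} <->
  forall e : R, 0 < e -> exists2 d : R, 0 < d &
    forall w, normc (w - z) < d -> normc (F w - F z) < e.
Proof.
split=> [Fz e e0|H].
  have : \forall w \near z, normc (F w - F z) < e.
    have /cvgr_distC_lt/(_ e%:C) := Fz; rewrite ltcR => /(_ e0).
    by apply: filterS => w; rewrite norm_normc ltcR.
  by move/nearcP.
rewrite /prop_for /continuous_at; apply/(@cvgrPdistC_lt _ _ _ _ (nbhs_filter z)) => e /cball_ex[d d0 ->].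
by apply/nearcP; have [d' d'0 H'] := H _ d0; exists d' => // w /H';
  rewrite norm_normc ltcR.
Qed.

(** Caratheodory's form of differentiability: it turns every divided difference
    with a continuous value into a derivative, so that no limit of difference
    quotients has to be handled afterwards. *)
Lemma derivable_factor (F F1 : C -> C) z :
  (\forall w \near z, F w = F z + (w - z) * F1 w) ->
  {for z, continuous F1} -> derivable F z 1.
Proof.
move=> /nearcP[e e0 H] cF1; apply/cvg_ex; exists (F1 z).
apply/cvgrPdistC_lt => d /cball_ex[{}d d0 ->].
have [d' d'0 H'] := (continuous_cP F1 z).1 cF1 _ d0.
apply/near_dnbhs_cP; exists (Num.min e d'); first by rewrite lt_min e0.
move=> h; rewrite subr0 lt_min => /andP[he hd] h0; rewrite norm_normc ltcR.
have hE : h *: (1 : C) = h by rewrite /GRing.scale /= mulr1.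
rewrite hE /= [F (h + z)]H ?addrK//.
have -> : F z + h * F1 (h + z) - F z = h * F1 (h + z) by ring.
have -> : h^-1 *: (h * F1 (h + z)) = F1 (h + z) by rewrite /GRing.scale /= mulKf.
by apply: H'; rewrite addrK.
Qed.

End ComplexModulus.

(** * Sums of geometrically dominated complex series *)

Section ComplexSeries.
Context {R : realType}.
Local Notation C := R[i].

Definition geo_bounded (u : nat -> C) (K : R) : Prop :=
  forall n, normc (u n) <= K * 2^-1 ^+ n.

Definition geo_boundedR (u : R^nat) (K : R) : Prop :=
  forall n, `|u n| <= K * 2^-1 ^+ n.

Lemma half_lt1 : `|2^-1 : R| < 1.
Proof. by rewrite ger0_norm ?invr_ge0// invf_lt1// ltr1n. Qed.

Lemma geo_boundedR_ge0 u K : geo_boundedR u K -> 0 <= K.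
Proof. by move/(_ 0%N); rewrite expr0 mulr1; apply: le_trans. Qed.

Lemma geo_boundedR_cvg_norm u K : geo_boundedR u K -> cvgn [normed series u].
Proof.
move=> H; apply: (@series_le_cvg _ _ (geometric K 2^-1)) => //.
- by move=> n; exact: normr_ge0.
- move=> n; by apply: geometric_ge0; rewrite ?invr_ge0//; exact: geo_boundedR_ge0 H.
- exact: is_cvg_geometric_series half_lt1.
Qed.

Lemma geo_boundedR_cvg u K : geo_boundedR u K -> cvgn (series u).
Proof. by move=> H; apply: normed_cvg; exact: geo_boundedR_cvg_norm H. Qed.

Lemma geo_boundedR_lim u K : geo_boundedR u K -> `|limn (series u)| <= 2 * K.
Proof.
move=> H; have cu := geo_boundedR_cvg_norm H.
apply: le_trans (lim_series_norm cu) _.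
have gK := @cvg_geometric_series _ K _ half_lt1.
have -> : 2 * K = K / (1 - 2^-1) by field.
rewrite -(cvg_lim (@Rhausdorff R) gK).
by apply: lim_series_le => //; apply/cvg_ex; eexists; exact: gK.
Qed.

Lemma limn_series_shift (u : R^nat) : cvgn (series u) ->
  limn (series u) = u 0%N + limn (series (u \o S)).
Proof.
move=> cu; suff -> : limn (series (u \o S)) = limn (series u) - u 0%N.
  by rewrite addrC subrK.
apply/cvg_lim; first exact: Rhausdorff.
have -> : series (u \o S) = (fun n => series u n.+1 - u 0%N).
  by apply/funext => n; rewrite /series /= big_nat_recl// addrC addKr.
by apply: cvgB; [rewrite (cvg_shiftS (series u))|exact: cvg_cst].
Qed.

(** The sum is taken on real and imaginary parts, where completeness of the real
    line gives convergence; every series below is dominated by a geometric one of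
    ratio 1/2, which makes all manipulations legitimate. *)
Definition csum (u : nat -> C) : C :=
  limn (series (fun n => complex.Re (u n))) +i*
  limn (series (fun n => complex.Im (u n))).

Section Bounded.
Variables (u : nat -> C) (K : R).
Hypothesis uK : geo_bounded u K.

Lemma geo_bounded_Re : geo_boundedR (fun n => complex.Re (u n)) K.
Proof. by move=> n; exact: le_trans (normRe_le _) (uK n). Qed.

Lemma geo_bounded_Im : geo_boundedR (fun n => complex.Im (u n)) K.
Proof. by move=> n; exact: le_trans (normIm_le _) (uK n). Qed.

Lemma normc_csum : normc (csum u) <= 4 * K.
Proof.
apply: le_trans (normc_leReIm _) _ => /=.
have := geo_boundedR_lim geo_bounded_Re; have := geo_boundedR_lim geo_bounded_Im.
lra.
Qed.

Lemma csum_shift : csum u = u 0%N + csum (u \o S).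
Proof.
apply: complex_ext; rewrite ?ReD ?ImD /= limn_series_shift//.
- exact: geo_boundedR_cvg geo_bounded_Re.
- exact: geo_boundedR_cvg geo_bounded_Im.
Qed.

Lemma csumZ (a : C) : csum (fun n => a * u n) = a * csum u.
Proof.
have cR := geo_boundedR_cvg geo_bounded_Re.
have cI := geo_boundedR_cvg geo_bounded_Im.
apply: complex_ext; rewrite ?ReM ?ImM /=.
- under eq_fun do rewrite ReM.
  rewrite -[X in X - _]/(complex.Re a *: limn _) -[X in _ - X]/(complex.Im a *: limn _).
  rewrite -!lim_seriesZ// -lim_seriesB//; [exact: is_cvg_seriesZ|exact: is_cvg_seriesZ].
- under eq_fun do rewrite ImM.
  rewrite -[X in X + _]/(complex.Re a *: limn _) -[X in _ + X]/(complex.Im a *: limn _).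
  rewrite -!lim_seriesZ// -lim_seriesD//; [exact: is_cvg_seriesZ|exact: is_cvg_seriesZ].
Qed.

End Bounded.

Lemma csumD u v K K' : geo_bounded u K -> geo_bounded v K' ->
  csum (fun n => u n + v n) = csum u + csum v.
Proof.
move=> uK vK'; apply: complex_ext; rewrite ?ReD ?ImD /=.
- under eq_fun do rewrite ReD.
  rewrite -lim_seriesD//; first exact: geo_boundedR_cvg (geo_bounded_Re uK).
  exact: geo_boundedR_cvg (geo_bounded_Re vK').
- under eq_fun do rewrite ImD.
  rewrite -lim_seriesD//; first exact: geo_boundedR_cvg (geo_bounded_Im uK).
  exact: geo_boundedR_cvg (geo_bounded_Im vK').
Qed.

End ComplexSeries.

(** * Entire functions as power series *)

Section EntireSeries.
Context {R : realType}.
Local Notation C := R[i].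
Implicit Types (a b : nat -> C) (w z : C).

(** Infinite radius of convergence, as a bound on the coefficients that is stable
    under all operations needed below. *)
Definition rapid a : Prop := forall rho : R, 1 <= rho ->
  exists K : R, forall k, normc (a k) * rho ^+ k <= K.

Definition eser a w : C := csum (fun k => a k * w ^+ k).

Lemma eq_eser a b w : a =1 b -> eser a w = eser b w.
Proof. by move=> /funext ->. Qed.

Lemma rapid_tail a (rho : R) : rapid a -> 1 <= rho ->
  exists2 K : R, 0 <= K & forall k z, 2 * normc z <= rho ->
    geo_bounded (fun m => a (m + k)%N * z ^+ m) (K * rho ^- k).
Proof.
move=> ra rho1; have [K HK] := ra _ rho1; have rho0 : 0 < rho by lra.
exists K => [|k z zrho m].
  by apply: le_trans (HK 0%N); rewrite mulr_ge0 ?normc_ge0// exprn_ge0// ltW.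
rewrite normcM normcX.
have zr : normc z <= rho / 2 by lra.
have -> : K * rho ^- k * 2^-1 ^+ m = (K * rho ^- (m + k)) * (rho / 2) ^+ m.
  rewrite exprMn exprD; field.
  by rewrite !expf_neq0//; lra.
apply: ler_pM; rewrite ?normc_ge0 ?exprn_ge0 ?normc_ge0//.
  by rewrite ler_pdivlMr ?exprn_gt0.
by rewrite lerXn2r ?nnegrE ?normc_ge0//; lra.
Qed.

Lemma rapid_geo a (M : R) : rapid a -> exists K : R, forall w, normc w <= M ->
  geo_bounded (fun k => a k * w ^+ k) K.
Proof.
move=> ra; pose rho := Num.max 1 (2 * M).
have rho1 : 1 <= rho by rewrite le_max lexx.
have [K K0 H] := rapid_tail ra rho1; exists K => w wM n.
have /H/(_ n) : 2 * normc w <= rho by rewrite le_max; apply/orP; right; lra.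
by move/(_ 0%N); rewrite addn0 expr0 invr1 mulr1.
Qed.

Lemma eser_bounded a (M : R) : rapid a ->
  exists K : R, forall w, normc w <= M -> normc (eser a w) <= K.
Proof.
move=> /(rapid_geo M)[K H]; exists (4 * K) => w /H; exact: normc_csum.
Qed.

Lemma rapid_shift a : rapid a -> rapid (a \o S).
Proof.
move=> ra rho rho1; have [K H] := ra _ rho1; exists K => k /=.
apply: le_trans (H k.+1); rewrite ler_wpM2l ?normc_ge0// exprS ler_peMl//.
by rewrite exprn_ge0//; lra.
Qed.

Lemma rapidD a b : rapid a -> rapid b -> rapid (fun k => a k + b k).
Proof.
move=> ra rb rho rho1; have [K H] := ra _ rho1; have [L H'] := rb _ rho1.
exists (K + L) => k; apply: le_trans (lerD (H k) (H' k)).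
by rewrite -mulrDl ler_wpM2r ?le_normcD// exprn_ge0//; lra.
Qed.

Lemma rapidZ c a : rapid a -> rapid (fun k => c * a k).
Proof.
move=> ra rho rho1; have [K H] := ra _ rho1.
by exists (normc c * K) => k; rewrite normcM -mulrA ler_wpM2l ?normc_ge0.
Qed.

Lemma rapidB a b : rapid a -> rapid b -> rapid (fun k => a k - b k).
Proof.
move=> ra rb; under eq_fun do rewrite -[- b _]mulN1r.
by apply: rapidD => //; exact: rapidZ.
Qed.

Lemma normc_nat n : normc (n%:R : C) = n%:R.
Proof. by rewrite -(rmorph_nat (real_complex R)) normcR ger0_norm. Qed.

Lemma rapid_natmul a : rapid a -> rapid (fun k => k%:R * a k).
Proof.
move=> ra rho rho1; have [K H] := ra (2 * rho) ltac:(lra).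
exists K => k; apply: le_trans (H k); rewrite normcM exprMn normc_nat.
rewrite [_ * normc _]mulrC -mulrA ler_wpM2l ?normc_ge0// ler_wpM2r//.
  by rewrite exprn_ge0//; lra.
by rewrite -natrX ler_nat ltnW// ltn_expl.
Qed.

(** Coefficients b_k = a_(k+1) + a_(k+2) z + a_(k+3) z^2 + ... of the quotient
    (F(w) - F(z)) / (w - z) as a power series in w, where F(w) is the sum of the
    a_k w^k. *)
Definition divdiff a z k : C := eser (fun m => a (m + k.+1)%N) z.

Lemma rapid_divdiff a z : rapid a -> rapid (divdiff a z).
Proof.
move=> ra rho rho1; pose rho' := Num.max rho (2 * normc z).
have rr' : rho <= rho' by rewrite le_max lexx.
have rho'1 : 1 <= rho' by lra.
have [K K0 H] := rapid_tail ra rho'1; exists (4 * K) => k.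
have zrho' : 2 * normc z <= rho' by rewrite le_max lexx orbT.
have Hk : normc (divdiff a z k) <= _ := normc_csum (H k.+1 z zrho').
apply: le_trans (ler_wpM2r _ Hk) _; first by rewrite exprn_ge0//; lra.
rewrite -!mulrA ler_pM2l// ler_piMr//.
rewrite mulrC ler_pdivrMr ?exprn_gt0// ?mul1r; last lra.
rewrite (le_trans (@lerXn2r _ k _ _ _ _ rr')) ?nnegrE//; try lra.
by rewrite exprS ler_peMl// exprn_ge0//; lra.
Qed.

Lemma eser_shift a w : rapid a -> eser a w = a 0%N + w * eser (a \o S) w.
Proof.
move=> ra; have [K H] := rapid_geo (normc w) ra.
rewrite /eser (csum_shift (H w (lexx _))) expr0 mulr1; congr (_ + _).
have [L H'] := rapid_geo (normc w) (rapid_shift ra).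
rewrite -(csumZ (H' w (lexx _))); congr csum; apply/funext => n /=.
by rewrite exprS; ring.
Qed.

Lemma eserD a b w : rapid a -> rapid b ->
  eser (fun k => a k + b k) w = eser a w + eser b w.
Proof.
move=> ra rb; have [K H] := rapid_geo (normc w) ra.
have [L H'] := rapid_geo (normc w) rb.
rewrite /eser -(csumD (H w (lexx _)) (H' w (lexx _))); congr csum.
by apply/funext => n; rewrite mulrDl.
Qed.

Lemma eserZ c a w : rapid a -> eser (fun k => c * a k) w = c * eser a w.
Proof.
move=> ra; have [K H] := rapid_geo (normc w) ra.
rewrite /eser -(csumZ (H w (lexx _))); congr csum.
by apply/funext => n; rewrite mulrA.
Qed.

Lemma eserB a b w : rapid a -> rapid b ->
  eser (fun k => a k - b k) w = eser a w - eser b w.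
Proof.
move=> ra rb; rewrite -[- eser b w]mulN1r -eserZ// -eserD//; last exact: rapidZ.
by apply: eq_eser => n; rewrite mulN1r.
Qed.

Lemma divdiffS a z k : rapid a ->
  divdiff a z k = a k.+1 + z * divdiff a z k.+1.
Proof.
move=> ra; rewrite /divdiff eser_shift ?add0n; last first.
  by elim: k.+1 => [|n IH]; [under eq_fun do rewrite addn0|
    under eq_fun do rewrite addnS; apply: rapid_shift IH].
have -> // : (fun m => a (m + k.+1)%N) \o S = (fun m => a (m + k.+2)%N).
by apply/funext => m /=; rewrite addSnnS.
Qed.

(** The tails satisfy b_k = a_(k+1) + z b_(k+1), hence (w - z) times the series of
    the b_k w^k telescopes term by term: no double series is rearranged.  Since the
    quotient is again entire, entire functions can be divided repeatedly, which
    replaces Cauchy's theory. *)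
Lemma divdiffE a z w : rapid a ->
  eser a w = eser a z + (w - z) * eser (divdiff a z) w.
Proof.
move=> ra; have rb := rapid_divdiff z ra; have ra' := rapid_shift ra.
have zb : z * eser (divdiff a z) w
    = z * divdiff a z 0 + w * eser (divdiff a z) w - w * eser (a \o S) w.
  rewrite -eserZ// eser_shift; last exact: rapidZ.
  rewrite -addrA; congr (_ + _); rewrite -mulrBr; congr (_ * _).
  rewrite -eserB//; apply: eq_eser => k /=.
  by rewrite [divdiff a z k]divdiffS//=; ring.
have az : eser a z = a 0%N + z * divdiff a z 0.
  rewrite eser_shift// /divdiff.
  have -> // : (fun m => a (m + 1)%N) = a \o S.
  by apply/funext => m; rewrite /= addn1.
by rewrite mulrBl zb az (eser_shift w ra); ring.
Qed.

(** The value of the quotient at w = z is the derivative.  Multiplying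
    b_k - z b_(k+1) = a_(k+1) by (k+1) z^k gives
    (k+1) a_(k+1) z^k = b_k z^k + k b_k z^k - (k+1) b_(k+1) z^(k+1),
    and the last two terms cancel after summation. *)
Lemma divdiff_diag a z : rapid a ->
  eser (divdiff a z) z = eser (fun k => k.+1%:R * a k.+1) z.
Proof.
move=> ra; set b := divdiff a z; have rb : rapid b := rapid_divdiff z ra.
have rkb := rapid_natmul rb.
have := eser_shift z rkb; rewrite mul0r add0r.
rewrite -eserZ; last exact: rapid_shift rkb.
have -> : eser (fun k => k.+1%:R * a k.+1) z
  = eser b z + (eser (fun k => k%:R * b k) z
     - eser (fun k => z * ((fun k => k%:R * b k) \o S) k) z).
  rewrite -eserB//; last by apply: rapidZ; exact: rapid_shift rkb.
  rewrite -eserD//; last first.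
    by apply: rapidB => //; apply: rapidZ; exact: rapid_shift rkb.
  apply: eq_eser => k; rewrite [b k]divdiffS//= -/b.
  by rewrite -[k.+1%:R]natr1; ring.
by move=> ->; rewrite subrr addr0.
Qed.

(** Continuity at z only needs the divided difference to be bounded near z. *)
Lemma eser_continuous a z : rapid a -> {for z, continuous (eser a)}.
Proof.
move=> ra; have rb := rapid_divdiff z ra.
have [K H] := eser_bounded (normc z + 1) rb.
have K0 : 0 <= K by apply: le_trans (normc_ge0 _) (H z _); lra.
apply/continuous_cP => e e0; exists (Num.min 1 (e / (K + 1))).
  by rewrite lt_min ltr01 divr_gt0//; lra.
move=> w; rewrite lt_min => /andP[w1 we].
rewrite (divdiffE z w ra) addrC addKr normcM.
have /H Kw : normc w <= normc z + 1.
  by have := le_normcD (w - z) z; rewrite subrK; lra.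
apply: le_lt_trans (ler_wpM2l (normc_ge0 _) Kw) _.
have : normc (w - z) * (K + 1) < e by rewrite -ltr_pdivlMr//; lra.
by have := normc_ge0 (w - z); lra.
Qed.

Lemma eser_derivable a z : rapid a -> derivable (eser a) z 1.
Proof.
move=> ra; apply: (@derivable_factor _ _ (eser (divdiff a z))).
  by apply/nearcP; exists 1 => // w _; exact: divdiffE.
exact/eser_continuous/rapid_divdiff.
Qed.

End EntireSeries.

(** * Complex valued functions of a real variable *)

Section RealVariable.
Context {R : realType}.
Local Notation C := R[i].
Implicit Types (f g : R -> C) (x : R).

Lemma real_complex_continuous : continuous (real_complex R : R -> C).
Proof.
move=> x; rewrite /continuous_at; apply/(@cvgrPdistC_lt _ _ _ _ (nbhs_filter x)) => e /cball_ex[d d0 ->].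
apply/nbhs_ballP; exists d => // t; rewrite -ball_normE /= distrC => tx.
by rewrite norm_normc -rmorphB normcR ltcR.
Qed.

Lemma Re_continuous : continuous (@complex.Re R : C -> R).
Proof.
move=> z; rewrite /continuous_at; apply/(@cvgrPdistC_lt _ _ _ _ (nbhs_filter z)) => e e0.
apply/nearcP; exists e => // w wz.
by rewrite -ReB (le_lt_trans (normRe_le _)).
Qed.

Lemma Im_continuous : continuous (@complex.Im R : C -> R).
Proof.
move=> z; rewrite /continuous_at; apply/(@cvgrPdistC_lt _ _ _ _ (nbhs_filter z)) => e e0.
apply/nearcP; exists e => // w wz.
by rewrite -ImB (le_lt_trans (normIm_le _)).
Qed.

Lemma is_derive_factor (h h1 : R -> R) x :
  (forall t, h t = h x + (t - x) * h1 t) ->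
  {for x, continuous h1} -> is_derive x 1 h (h1 x).
Proof.
move=> H ch1.
have cv : (fun e : R => e^-1 *: (h (e *: 1 + x) - h x)) e @[e --> 0^'] --> h1 x.
  have E : \forall e \near (0:R)^', h1 (e + x) = e^-1 *: (h (e *: 1 + x) - h x).
    near=> e; have e0 : e != 0 by near: e; exact: nbhs_dnbhs_neq.
    rewrite /GRing.scale /= mulr1 H addrK.
    have -> : h x + e * h1 (e + x) - h x = e * h1 (e + x) by ring.
    by rewrite mulKf.
  apply: cvg_trans; first exact: (near_eq_cvg E).
  apply: cvg_within_filter.
  apply: (@cvg_comp _ _ _ (fun e => e + x) h1 (nbhs 0) (nbhs x)) => //.
  have : e + x @[e --> 0] --> 0 + x by apply: cvgD; [exact: cvg_id|exact: cvg_cst].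
  by rewrite add0r.
apply: DeriveDef; first by apply/cvg_ex; exists (h1 x).
exact/cvg_lim.
Unshelve. all: by end_near. Qed.

Lemma is_cderive_factor f f1 x :
  (forall t, f t = f x + (t - x)%:C * f1 t) ->
  {for x, continuous f1} -> is_cderive f x (f1 x).
Proof.
move=> H cf1; split.
- apply: (@is_derive_factor _ (fun t => complex.Re (f1 t))) => [t|].
    by rewrite H ReD ReM /=; ring.
  by apply: continuous_comp => //; exact: Re_continuous.
- apply: (@is_derive_factor _ (fun t => complex.Im (f1 t))) => [t|].
    by rewrite H ImD ImM /=; ring.
  by apply: continuous_comp => //; exact: Im_continuous.
Qed.

Lemma is_cderive_eq f x d d' : is_cderive f x d -> d = d' -> is_cderive f x d'.
Proof. by move=> + <-. Qed.

Lemma is_cderive_cst c x : is_cderive (fun=> c) x 0.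
Proof. by split => /=; exact: is_derive_cst. Qed.

Lemma is_cderive_id x : is_cderive (fun t => t%:C) x 1.
Proof. by split => /=; [exact: is_derive_id|exact: is_derive_cst]. Qed.

Lemma is_cderiveD f g x df dg : is_cderive f x df -> is_cderive g x dg ->
  is_cderive (fun t => f t + g t) x (df + dg).
Proof.
move=> [f1 f2] [g1 g2]; split.
- by rewrite ReD; under eq_fun do rewrite ReD; exact: is_deriveD.
- by rewrite ImD; under eq_fun do rewrite ImD; exact: is_deriveD.
Qed.

Lemma is_cderiveM f g x df dg : is_cderive f x df -> is_cderive g x dg ->
  is_cderive (fun t => f t * g t) x (df * g x + f x * dg).
Proof.
move=> [f1 f2] [g1 g2]; split.
- under eq_fun do rewrite ReM.
  apply: is_derive_eq; rewrite /GRing.scale /= ReD !ReM; ring.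
- under eq_fun do rewrite ImM.
  apply: is_derive_eq; rewrite /GRing.scale /= ImD !ImM; ring.
Qed.

Lemma is_cderiveZ c f x df : is_cderive f x df ->
  is_cderive (fun t => c * f t) x (c * df).
Proof.
move=> fd; have := is_cderiveM (is_cderive_cst c x) fd.
by rewrite mul0r add0r.
Qed.

Lemma is_cderiveB f g x df dg : is_cderive f x df -> is_cderive g x dg ->
  is_cderive (fun t => f t - g t) x (df - dg).
Proof.
move=> fd gd; rewrite -[- dg]mulN1r; under eq_fun do rewrite -[- g _]mulN1r.
by apply: is_cderiveD => //; exact: is_cderiveZ.
Qed.

Lemma is_cderive_conj f x df : is_cderive f x df ->
  is_cderive (fun t => conjc (f t)) x (conjc df).
Proof.
move=> [f1 f2]; split.
- have -> : (fun t => complex.Re (conjc (f t))) = (fun t => complex.Re (f t)).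
    by apply/funext => t; case: (f t).
  by case: df f1 {f2}.
- have -> : (fun t => complex.Im (conjc (f t))) = (fun t => - complex.Im (f t)).
    by apply/funext => t; case: (f t).
  have -> : complex.Im (conjc df) = - complex.Im df by case: df {f1 f2}.
  exact: is_deriveN.
Qed.

Lemma cderiveE f x d : is_cderive f x d -> cderive f x = d.
Proof.
move=> [f1 f2]; rewrite /cderive !derive1E.
by rewrite (@derive_val _ _ _ _ _ _ _ f1) (@derive_val _ _ _ _ _ _ _ f2); case: d {f1 f2}.
Qed.

Lemma is_cderive_unique f x d d' :
  is_cderive f x d -> is_cderive f x d' -> d = d'.
Proof. by move=> /cderiveE <- /cderiveE <-. Qed.

Lemma cderivableP f x : cderivable f x -> is_cderive f x (cderive f x).
Proof. by move=> [d fd]; rewrite (cderiveE fd). Qed.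

Lemma is_cderive_near f g x d : (\forall t \near x, f t = g t) ->
  is_cderive f x d -> is_cderive g x d.
Proof.
move=> fg [f1 f2]; split; apply: near_eq_is_derive; try eassumption.
all: by apply: filterS fg => t ->.
Qed.

Lemma is_cderive_continuous f x d : is_cderive f x d -> {for x, continuous f}.
Proof.
move=> [[f1 _] [f2 _]].
have cR : {for x, continuous (fun t => complex.Re (f t))}.
  exact/differentiable_continuous/derivable1_diffP.
have cI : {for x, continuous (fun t => complex.Im (f t))}.
  exact/differentiable_continuous/derivable1_diffP.
have -> : f = (fun t => (complex.Re (f t))%:C + 'i * (complex.Im (f t))%:C).
  by apply/funext => t; rewrite -complexE.
apply: cvgD.
  apply: (@continuous_comp _ _ _ (fun t => complex.Re (f t)) (real_complex R) x) => //.
  exact: real_complex_continuous.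
apply: cvgM; first exact: cvg_cst.
apply: (@continuous_comp _ _ _ (fun t => complex.Im (f t)) (real_complex R) x) => //.
exact: real_complex_continuous.
Qed.

Lemma is_cderive_0_is_cst f : (forall x, is_cderive f x 0) -> forall x y, f x = f y.
Proof.
move=> H x y; apply: complex_ext.
- by apply: (@is_derive_0_is_cst _ (fun t => complex.Re (f t))) => t; have [] := H t.
- by apply: (@is_derive_0_is_cst _ (fun t => complex.Im (f t))) => t; have [] := H t.
Qed.

End RealVariable.

(** * The fundamental system of - f'' = w f *)

Section EdgeSolutions.
Context {R : realType}.
Local Notation C := R[i].
Implicit Types (w y z : C) (x t : R) (m : nat).

(** Phi m y is the sum of (-y)^k / (2k+m)!, so that cos(x sqrt w) = Phi 0 (w x^2)
    and sin(x sqrt w) / sqrt w = x Phi 1 (w x^2): in this form no square root of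
    the complex number w appears and both are visibly entire in w.  The functions
    Phi 2 and Phi 3 enter through the derivatives with respect to w. *)
Definition Phi_coef m k : C := (-1) ^+ k / (k.*2 + m)`!%:R.

Definition Phi m y : C := eser (Phi_coef m) y.

Lemma fact_neq0 n : (n`!%:R : C) != 0.
Proof. by rewrite pnatr_eq0 -lt0n fact_gt0. Qed.

Lemma rapid_Phi_coef m : rapid (Phi_coef m).
Proof.
move=> rho rho1; exists (expR rho) => k.
have rho0 : 0 <= rho by lra.
rewrite /Phi_coef normcM normcX normcN normc1 expr1n mul1r normcV normc_nat.
have ek : rho ^+ k / k`!%:R <= expR rho.
  case: k => [|k]; first by rewrite expr0 fact0 divr1 -expR0 ler_expR.
  by have := expR_ge1Dxn k rho0; lra.
apply: le_trans ek; rewrite mulrC ler_wpM2l ?exprn_ge0//.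
rewrite lef_pV2 ?posrE ?ltr0n ?fact_gt0// ler_nat.
apply: leq_fact; rewrite -addnn -addnA; exact: leq_addr.
Qed.

Lemma Phi_rec m y : Phi m y = (m`!%:R)^-1 - y * Phi m.+2 y.
Proof.
rewrite /Phi eser_shift; last exact: rapid_Phi_coef.
rewrite {1}/Phi_coef expr0 mul1r double0 add0n -mulrN; congr (_ + _ * _).
rewrite -[RHS]mulN1r -eserZ; last exact: rapid_Phi_coef.
apply: eq_eser => k; rewrite /Phi_coef /= exprS doubleS mulrA.
by rewrite !addSn !addnS.
Qed.

(** The derivative of Phi m, from 2 (k+1) = (2k+m+2) - m. *)
Definition dPhi m y : C := - 2^-1 * (Phi m.+1 y - m%:R * Phi m.+2 y).

Lemma Phi_diag m z : eser (fun k => k.+1%:R * Phi_coef m k.+1) z = dPhi m z.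
Proof.
have r1 := @rapid_Phi_coef m.+1; have r2 := rapidZ m%:R (@rapid_Phi_coef m.+2).
rewrite /dPhi /Phi -[m%:R * _]eserZ; last exact: rapid_Phi_coef.
rewrite -(eserB _ r1 r2) -(eserZ _ _ (rapidB r1 r2)).
apply: eq_eser => k; rewrite /Phi_coef exprS doubleS !addSn !addnS.
set N := (k.*2 + m)%N; rewrite (factS N.+1) natrM.
have -> : (N.+2%:R : C) = 2 * k.+1%:R + m%:R.
  by rewrite /N -mul2n -natrM -natrD; congr _%:R; lia.
have e0 : (2 * k.+1%:R + m%:R : C) != 0.
  by rewrite -natrM -natrD pnatr_eq0.
move: (fact_neq0 N.+1) e0.
move: (k.+1%:R) (m%:R) (N.+1`!%:R) ((-1) ^+ k) => a b c d c0 e0.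
by field; rewrite c0 e0.
Qed.

Lemma Phi_cderive m w x :
  is_cderive (fun t => Phi m (w * (t%:C ^+ 2))) x
    (2 * w * x%:C * dPhi m (w * (x%:C ^+ 2))).
Proof.
set z := w * _.
pose f1 t := w * (t%:C + x%:C) * eser (divdiff (Phi_coef m) z) (w * (t%:C ^+ 2)).
have -> : 2 * w * x%:C * dPhi m z = f1 x.
  rewrite -Phi_diag -divdiff_diag; last exact: rapid_Phi_coef.
  by rewrite /f1 -/z; ring.
apply: is_cderive_factor => [t|].
  rewrite /Phi (divdiffE z); last exact: rapid_Phi_coef.
  congr (_ + _); rewrite /f1; move: (eser (divdiff _ _) _) => E.
  by rewrite /z rmorphB /=; ring.
have ct : {for x, continuous (fun t : R => t%:C)} by exact: real_complex_continuous.
apply: cvgM; first by apply: cvgM; [exact: cvg_cst|apply: cvgD => //; exact: cvg_cst].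
apply: (@continuous_comp _ _ _ (fun t : R => w * t%:C ^+ 2)
  (eser (divdiff (Phi_coef m) z)) x).
  by apply: cvgM; [exact: cvg_cst|exact: cvgM].
by apply: eser_continuous; apply: rapid_divdiff; exact: rapid_Phi_coef.
Qed.

(** Solutions of - f'' = w f with Cauchy data (1, 0) and (0, 1) at the origin. *)
Definition cosw w x : C := Phi 0 (w * (x%:C ^+ 2)).
Definition sinw w x : C := x%:C * Phi 1 (w * (x%:C ^+ 2)).

Lemma cosw_cderive w x : is_cderive (cosw w) x (- (w * sinw w x)).
Proof.
apply: is_cderive_eq (Phi_cderive 0 w x) _.
by rewrite /sinw /dPhi; field.
Qed.

Lemma sinw_cderive w x : is_cderive (sinw w) x (cosw w x).
Proof.
apply: is_cderive_eq (is_cderiveM (is_cderive_id x) (Phi_cderive 1 w x)) _.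
by rewrite /cosw (Phi_rec 0) (Phi_rec 1) (erefl : 0`! = 1)%N (erefl : 1`! = 1)%N /dPhi; field.
Qed.

Lemma Phi0 m : Phi m 0 = (m`!%:R)^-1.
Proof. by rewrite Phi_rec mul0r subr0. Qed.

Lemma cosw0 w : cosw w 0 = 1.
Proof. by rewrite /cosw expr0n mulr0 Phi0 fact0 invr1. Qed.

Lemma sinw0 w : sinw w 0 = 0.
Proof. by rewrite /sinw mul0r. Qed.

Lemma cosw2Dsinw2 w x : cosw w x ^+ 2 + w * sinw w x ^+ 2 = 1.
Proof.
pose F x := cosw w x * cosw w x + w * (sinw w x * sinw w x).
suff : F x = F 0 by rewrite /F cosw0 sinw0 !(mulr0, mulr1, addr0).
apply: is_cderive_0_is_cst => t; rewrite /F.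
have dc := cosw_cderive w t; have ds := sinw_cderive w t.
apply: is_cderive_eq (is_cderiveD (is_cderiveM dc dc)
  (is_cderiveZ w (is_cderiveM ds ds))) _.
by ring.
Qed.

(** Derivatives of cosw and sinw with respect to w, written in a form whose
    derivatives with respect to x are computed by the rules above. *)
Definition dcosw w x : C := - 2^-1 * (x%:C * sinw w x).
Definition dsinw w x : C :=
  - 2^-1 * (x%:C ^+ 3 * (Phi 2 (w * (x%:C ^+ 2)) - Phi 3 (w * (x%:C ^+ 2)))).

Lemma w_dsinw w x : w * dsinw w x = - 2^-1 * (sinw w x - x%:C * cosw w x).
Proof.
rewrite /dsinw /sinw /cosw (Phi_rec 0) (Phi_rec 1) (erefl : 0`! = 1)%N (erefl : 1`! = 1)%N.
by field.
Qed.

Lemma dcosw_cderive w x :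
  is_cderive (dcosw w) x (- (sinw w x + w * dsinw w x)).
Proof.
apply: is_cderive_eq (is_cderiveZ _ (is_cderiveM (is_cderive_id x) (sinw_cderive w x))) _.
by rewrite w_dsinw; field.
Qed.

Lemma dsinw_cderive w x : is_cderive (dsinw w) x (dcosw w x).
Proof.
have d3 : is_cderive (fun t => t%:C ^+ 3) x (3 * x%:C ^+ 2).
  have dx := is_cderive_id x.
  under eq_fun do rewrite 2!exprS expr1.
  by apply: is_cderive_eq (is_cderiveM dx (is_cderiveM dx dx)) _; ring.
apply: is_cderive_eq (is_cderiveZ _ (is_cderiveM d3
  (is_cderiveB (Phi_cderive 2 w x) (Phi_cderive 3 w x)))) _.
rewrite /dcosw /sinw /dPhi.
rewrite (Phi_rec 1) (Phi_rec 2) (Phi_rec 3).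
rewrite (erefl : 1`! = 1)%N (erefl : 2`! = 2)%N (erefl : 3`! = 6)%N.
by field.
Qed.

Lemma rapid_geom (a : nat -> C) q : rapid a -> rapid (fun k => a k * q ^+ k).
Proof.
move=> ra rho rho1; pose rho' := Num.max 1 (normc q * rho).
have [K H] := ra rho' ltac:(by rewrite le_max lexx); exists K => k.
apply: le_trans (H k); rewrite normcM normcX -mulrA ler_wpM2l ?normc_ge0//.
rewrite -exprMn lerXn2r ?nnegrE ?mulr_ge0 ?normc_ge0//; try lra.
- by rewrite le_max ler01.
- by rewrite le_max lexx orbT.
Qed.

Lemma eser_geom (a : nat -> C) q w : eser (fun k => a k * q ^+ k) w = eser a (w * q).
Proof.
by rewrite /eser; congr csum; apply/funext => k; rewrite exprMn mulrA mulrAC.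
Qed.

Lemma eser_geom_diag (a : nat -> C) q z : rapid a ->
  eser (divdiff (fun k => a k * q ^+ k) z) z
  = q * eser (fun k => k.+1%:R * a k.+1) (z * q).
Proof.
move=> ra; rewrite divdiff_diag; last exact: rapid_geom.
rewrite -eserZ; last exact: (rapid_shift (rapid_natmul ra)).
rewrite -eser_geom; apply: eq_eser => k; rewrite exprS; ring.
Qed.

(** At a fixed point x the solutions are entire in w; the series is kept, rather
    than only the derivative, because it is divided twice later. *)
Lemma cosw_entire x : exists a, [/\ rapid a, forall w, cosw w x = eser a w &
  forall z, eser (divdiff a z) z = dcosw z x].
Proof.
exists (fun k => Phi_coef 0 k * (x%:C ^+ 2) ^+ k); split=> [|w|z].
- by apply: rapid_geom; exact: rapid_Phi_coef.
- by rewrite eser_geom.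
- rewrite eser_geom_diag; last exact: rapid_Phi_coef.
  by rewrite Phi_diag /dcosw /sinw /dPhi; field.
Qed.

Lemma sinw_entire x : exists a, [/\ rapid a, forall w, sinw w x = eser a w &
  forall z, eser (divdiff a z) z = dsinw z x].
Proof.
have ra := @rapid_Phi_coef 1.
exists (fun k => x%:C * Phi_coef 1 k * (x%:C ^+ 2) ^+ k); split=> [|w|z].
- by apply: rapid_geom; apply: rapidZ.
- by rewrite eser_geom eserZ.
- rewrite eser_geom_diag; last exact: rapidZ.
  under eq_eser do rewrite mulrCA.
  rewrite eserZ ?Phi_diag; last exact: rapid_shift (rapid_natmul ra).
  by rewrite /dsinw /dPhi; field.
Qed.

End EdgeSolutions.

(** * Analytic functions and inverses of analytic matrices *)

Section Holomorphy.
Context {R : realType}.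
Local Notation C := R[i].
Implicit Types (F G : C -> C) (z w : C).

Definition canalytic F z : Prop := \forall w \near z, derivable F w 1.

(** Analytic functions whose divided difference at z is analytic as well.  This
    is what is needed to subtract the polar part at z, and it is stable under
    algebraic operations, hence passes to determinants and inverse matrices. *)
Definition holo1 F z : Prop := exists2 F1, canalytic F1 z &
  \forall w \near z, F w = F z + (w - z) * F1 w.

Lemma nearW_C (P : set C) z : (forall w, P w) -> \forall w \near z, P w.
Proof. by move=> H; apply/nearcP; exists 1. Qed.

Lemma canalytic_near F G z : (\forall w \near z, F w = G w) ->
  canalytic F z -> canalytic G z.
Proof.
move=> /near_join FG aF; apply: filterS2 FG aF => w FG.
exact: near_eq_derivable.
Qed.

Lemma canalytic_cst c z : canalytic (fun=> c) z.
Proof. by apply: nearW_C => w; exact: derivable_cst. Qed.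

Lemma canalytic_id z : canalytic id z.
Proof. by apply: nearW_C => w; exact: derivable_id. Qed.

Lemma canalyticD F G z : canalytic F z -> canalytic G z ->
  canalytic (fun w => F w + G w) z.
Proof. by apply: filterS2 => w; exact: derivableD. Qed.

Lemma canalyticM F G z : canalytic F z -> canalytic G z ->
  canalytic (fun w => F w * G w) z.
Proof. by apply: filterS2 => w; exact: derivableM. Qed.

Lemma canalytic_continuous F z : canalytic F z -> {for z, continuous F}.
Proof. by move=> /nbhs_singleton/derivable1_diffP/differentiable_continuous. Qed.

Lemma near_neq0 F z : {for z, continuous F} -> F z != 0 ->
  \forall w \near z, F w != 0.
Proof.
move=> /continuous_cP cF; rewrite -normc_gt0 => /cF[d d0 H].
apply/nearcP; exists d => // w /H; apply: contraTneq => ->.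
by rewrite sub0r normcN ltxx.
Qed.

Lemma canalyticV F z : canalytic F z -> F z != 0 ->
  canalytic (fun w => (F w)^-1) z.
Proof.
move=> aF /(near_neq0 (canalytic_continuous aF)).
by apply: filterS2 aF => w dF F0; exact: derivableV.
Qed.

Lemma canalyticB F z c : canalytic F z -> canalytic (fun w => F w - c) z.
Proof. by move=> aF; exact: (canalyticD aF (canalytic_cst (- c) z)). Qed.

Lemma holo1_canalytic F z : holo1 F z -> canalytic F z.
Proof.
move=> [F1 aF1 HF]; apply: (@canalytic_near (fun w => F z + (w - z) * F1 w)).
  by apply: filterS HF => w ->.
apply: (canalyticD (canalytic_cst (F z) z)).
exact: (canalyticM (canalyticB z (canalytic_id z)) aF1).
Qed.

Lemma holo1_near F G z : (\forall w \near z, F w = G w) -> holo1 F z -> holo1 G z.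
Proof.
move=> FG [F1 aF1 HF]; exists F1 => //.
have FGz : F z = G z := nbhs_singleton FG.
by apply: filterS2 FG HF => w <- ->; rewrite FGz.
Qed.

Lemma holo1_cst c z : holo1 (fun=> c) z.
Proof.
by exists (fun=> 0); [exact: canalytic_cst|apply: nearW_C => w; rewrite mulr0 addr0].
Qed.

Lemma holo1_id z : holo1 id z.
Proof.
exists (fun=> 1); first exact: canalytic_cst.
by apply: nearW_C => w; rewrite mulr1 addrC subrK.
Qed.

Lemma holo1D F G z : holo1 F z -> holo1 G z -> holo1 (fun w => F w + G w) z.
Proof.
move=> [F1 aF1 HF] [G1 aG1 HG]; exists (fun w => F1 w + G1 w).
  exact: canalyticD.
by apply: filterS2 HF HG => w -> ->; ring.
Qed.

Lemma holo1M F G z : holo1 F z -> holo1 G z -> holo1 (fun w => F w * G w) z.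
Proof.
move=> [F1 aF1 HF] hG; have [G1 aG1 HG] := hG.
exists (fun w => F1 w * G w + F z * G1 w).
  apply: (canalyticD (canalyticM aF1 (holo1_canalytic hG))).
  exact: (canalyticM (canalytic_cst (F z) z) aG1).
by apply: filterS2 HF HG => w -> ->; ring.
Qed.

Lemma holo1V F z : holo1 F z -> F z != 0 -> holo1 (fun w => (F w)^-1) z.
Proof.
move=> hF Fz; have aF := holo1_canalytic hF; have [F1 aF1 HF] := hF.
exists (fun w => - (F z)^-1 * (F1 w * (F w)^-1)).
  exact: (canalyticM (canalytic_cst _ z) (canalyticM aF1 (canalyticV aF Fz))).
apply: filterS2 HF (near_neq0 (canalytic_continuous aF) Fz) => w HF Fw.
have HF' : (w - z) * F1 w = F w - F z by rewrite HF; ring.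
rewrite mulrA [(w - z) * _]mulrC -mulrA [(w - z) * _]mulrA HF'.
by field; rewrite Fz Fw.
Qed.

Lemma holo1_sum (I : Type) (r : seq I) (P : pred I) (F : I -> C -> C) z :
  (forall i, P i -> holo1 (F i) z) -> holo1 (fun w => \sum_(i <- r | P i) F i w) z.
Proof.
move=> H; elim: r => [|i r IH].
  by under eq_fun do rewrite big_nil; exact: holo1_cst.
have [Pi|Pi] := boolP (P i); last by under eq_fun do rewrite big_cons (negbTE Pi).
by under eq_fun do rewrite big_cons Pi; apply: holo1D => //; exact: H.
Qed.

Lemma holo1_prod (I : Type) (r : seq I) (P : pred I) (F : I -> C -> C) z :
  (forall i, P i -> holo1 (F i) z) -> holo1 (fun w => \prod_(i <- r | P i) F i w) z.
Proof.
move=> H; elim: r => [|i r IH].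
  by under eq_fun do rewrite big_nil; exact: holo1_cst.
have [Pi|Pi] := boolP (P i); last by under eq_fun do rewrite big_cons (negbTE Pi).
by under eq_fun do rewrite big_cons Pi; apply: holo1M => //; exact: H.
Qed.

Lemma holo1_eser a z : rapid a -> holo1 (eser a) z.
Proof.
move=> ra; exists (eser (divdiff a z)).
  by apply: nearW_C => w; exact: eser_derivable (rapid_divdiff z ra).
by apply: nearW_C => w; exact: divdiffE.
Qed.

Definition holo1_mx m n (M : C -> 'M[C]_(m, n)) z : Prop :=
  forall i j, holo1 (fun w => M w i j) z.

Lemma holo1_mx_cst m n (A : 'M[C]_(m, n)) z : holo1_mx (fun=> A) z.
Proof. by move=> i j; exact: holo1_cst. Qed.

Lemma holo1_mxD m n (M N : C -> 'M[C]_(m, n)) z :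
  holo1_mx M z -> holo1_mx N z -> holo1_mx (fun w => M w + N w) z.
Proof. by move=> hM hN i j; under eq_fun do rewrite mxE; exact: holo1D. Qed.

Lemma holo1_mxM m n p (M : C -> 'M[C]_(m, n)) (N : C -> 'M[C]_(n, p)) z :
  holo1_mx M z -> holo1_mx N z -> holo1_mx (fun w => M w *m N w) z.
Proof.
move=> hM hN i j; under eq_fun do rewrite mxE.
by apply: holo1_sum => k _; exact: holo1M.
Qed.

Lemma holo1_det n (M : C -> 'M[C]_n) z : holo1_mx M z -> holo1 (fun w => \det (M w)) z.
Proof.
move=> hM; apply: holo1_sum => s _.
by apply: holo1M; [exact: holo1_cst|apply: holo1_prod => i _; exact: hM].
Qed.

Lemma holo1_adj n (M : C -> 'M[C]_n) z : holo1_mx M z -> holo1_mx (fun w => \adj (M w)) z.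
Proof.
move=> hM i j; under eq_fun do rewrite mxE /cofactor.
apply: holo1M; first exact: holo1_cst.
by apply: holo1_det => k l; under eq_fun do rewrite !mxE; exact: hM.
Qed.

Lemma near_unitmx n (M : C -> 'M[C]_n) z : holo1_mx M z -> M z \in unitmx ->
  \forall w \near z, M w \in unitmx.
Proof.
move=> hM; rewrite unitmxE unitfE => Mz.
have := near_neq0 (canalytic_continuous (holo1_canalytic (holo1_det hM))) Mz.
by apply: filterS => w; rewrite unitmxE unitfE.
Qed.

Lemma holo1_invmx n (M : C -> 'M[C]_n) z : holo1_mx M z -> M z \in unitmx ->
  holo1_mx (fun w => invmx (M w)) z.
Proof.
move=> hM Mz i j.
apply: (@holo1_near (fun w => (\det (M w))^-1 * \adj (M w) i j)).
  by apply: filterS (near_unitmx hM Mz) => w Mw; rewrite /invmx Mw [RHS]mxE.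
apply: holo1M; last exact: holo1_adj.
by apply: holo1V; [exact: holo1_det|rewrite -unitfE -unitmxE].
Qed.

Lemma holo1_mx_quotient m n (M : C -> 'M[C]_(m, n)) z : holo1_mx M z ->
  exists2 M1 : C -> 'M[C]_(m, n), forall i j, canalytic (fun w => M1 w i j) z &
    \forall w \near z, M w = M z + (w - z) *: M1 w.
Proof.
move=> hM.
have /choice[f Hf] : forall p : 'I_m * 'I_n, exists F1, canalytic F1 z /\
    \forall w \near z, M w p.1 p.2 = M z p.1 p.2 + (w - z) * F1 w.
  by move=> [i j]; have [F1 aF1 HF] := hM i j; exists F1.
exists (fun w => \matrix_(i, j) f (i, j) w).
  by move=> i j; under eq_fun do rewrite mxE; exact: (Hf (i, j)).1.
have : \forall w \near z, forall p, M w p.1 p.2 = M z p.1 p.2 + (w - z) * f p w.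
  by apply: (@filter_forall _ _ _ _ (nbhs_filter z)) => p; exact: (Hf p).2.
apply: filterS => w H; apply/matrixP => i j; rewrite !mxE; exact: (H (i, j)).
Qed.

Lemma unitmx_of_inj n (M : 'M[C]_n) :
  (forall x : 'rV_n, x *m M = 0 -> x = 0) -> M \in unitmx.
Proof.
move=> H; rewrite -row_free_unit -kermx_eq0; apply/rowV0P => v /sub_kermxP.
exact: H.
Qed.

Lemma ker_projection n (M : 'M[C]_n) : exists P : 'M[C]_n,
  [/\ P *m M = 0, P *m P = P, forall x : 'rV_n, x *m M = 0 -> x *m P = x &
      \rank P = \rank (kermx M)].
Proof.
pose L := col_ebase M; have Lu : L \in unitmx := col_ebase_unit M.
pose r := \rank M; pose P := L *m copid_mx r *m invmx L.
have PM : P *m M = 0.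
  rewrite /P -[X in _ *m X](mulmx_ebase M) !mulmxA mulmxKV// -[L *m _ *m _]mulmxA.
  by rewrite mul_copid_mx_pid ?mulmx0 ?mul0mx// rank_leq_row.
have xP : forall x : 'rV_n, x *m M = 0 -> x *m P = x.
  move=> x xM.
  have xLp : x *m L *m pid_mx r = 0 :> 'M[C]_(1, n).
    have xM' : x *m L *m pid_mx r *m row_ebase M = 0.
      by rewrite -xM -[in RHS](mulmx_ebase M) !mulmxA.
    by rewrite -[LHS](mulmxK (row_ebase_unit M)) xM' mul0mx.
  by rewrite /P !mulmxA /copid_mx mulmxBr mulmx1 xLp subr0 mulmxK.
exists P; split; [exact: PM| |exact: xP|].
  by apply/row_matrixP => i; rewrite row_mul xP// -row_mul PM row0.
apply/eqP; rewrite eqn_leq; apply/andP; split; apply: mxrankS.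
  by apply/sub_kermxP.
apply/row_subP => i; rewrite -(xP (row i (kermx M))); last first.
  by rewrite -row_mul mulmx_ker row0.
exact: submxMl.
Qed.

(** A matrix T(w) = T(z) + (w - z) T1(w) without Jordan chain at z has an inverse
    with at most a simple pole at z.  With P an idempotent onto the left kernel of
    T(z), Q = 1 - P and T2 = Q T + P T1, one has T(w) = (Q + (w - z) P) T2(w); the
    absence of chains is the invertibility of T2(z).  Hence
    T(w)^-1 = T2(w)^-1 (Q + (w - z)^-1 P), so T(w) is invertible near z, except
    at z itself when the kernel is nonzero, and the residue A = T2(z)^-1 P has the
    rank of the kernel. *)
Lemma simple_pole_inverse n (T T1 : C -> 'M[C]_n) z :
  holo1_mx T z -> holo1_mx T1 z ->
  (forall w, T w = T z + (w - z) *: T1 w) ->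
  (forall u v : 'rV[C]_n, u *m T z = 0 -> u *m T1 z + v *m T z = 0 -> u = 0) ->
  exists (A : 'M[C]_n) (h : C -> 'M[C]_n), [/\ forall i j, canalytic (fun w => h w i j) z,
    A *m T z = 0, T z *m A = 0, \rank A = \rank (kermx (T z)) &
    \forall w \near z^', T w \in unitmx /\ invmx (T w) = (w - z)^-1 *: A + h w].
Proof.
move=> hT hT1 TE nojordan; have [P [PT PP xP rP]] := ker_projection (T z).
have [Q QE] : exists Q : 'M[C]_n, Q = 1%:M - P by eexists.
have QP : Q *m P = 0 by rewrite QE mulmxBl mul1mx PP subrr.
have PQ : P *m Q = 0 by rewrite QE mulmxBr mulmx1 PP subrr.
have QQ : Q *m Q = Q by rewrite {1}QE mulmxBl mul1mx PQ subr0.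
have PDQ : Q + P = 1%:M by rewrite QE subrK.
have QT : Q *m T z = T z by rewrite QE mulmxBl mul1mx PT subr0.
pose T2 w := Q *m T w + P *m T1 w.
have hT2 : holo1_mx T2 z.
  by apply: holo1_mxD; apply: holo1_mxM => //; exact: holo1_mx_cst.
have T2z : T2 z \in unitmx.
  apply: unitmx_of_inj => x xT2.
  have xP0 : x *m P = 0.
    apply: (nojordan _ (x *m Q)); first by rewrite -mulmxA PT mulmx0.
    by rewrite -!mulmxA -mulmxDr addrC.
  rewrite -(xP x) ?xP0//; move: xT2; rewrite /T2 mulmxDr !mulmxA xP0 mul0mx addr0.
  by rewrite -mulmxA QT.
have PTw w : P *m T w = (w - z) *: (P *m T1 w).
  by rewrite TE mulmxDr PT add0r -scalemxAr.
have TT2 w : T w = (Q + (w - z) *: P) *m T2 w.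
  rewrite /T2 mulmxDl !mulmxDr -!scalemxAl !mulmxA QQ QP PQ PP.
  by rewrite !mul0mx scaler0 addr0 add0r -PTw -mulmxDl PDQ mul1mx.
have hV : holo1_mx (fun w => invmx (T2 w)) z by exact: holo1_invmx.
have hVP : holo1_mx (fun w => invmx (T2 w) *m P) z.
  by apply: holo1_mxM => //; exact: holo1_mx_cst.
have [G1 aG1 HG1] := holo1_mx_quotient hVP.
have hVQ : holo1_mx (fun w => invmx (T2 w) *m Q) z.
  by apply: holo1_mxM => //; exact: holo1_mx_cst.
exists (invmx (T2 z) *m P), (fun w => invmx (T2 w) *m Q + G1 w).
split.
- move=> i j; have := canalyticD (holo1_canalytic (hVQ i j)) (aG1 i j).
  by apply: canalytic_near; apply: nearW_C => w; rewrite [RHS]mxE.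
- by rewrite -mulmxA PT mulmx0.
- by rewrite {1}TT2 subrr scale0r addr0 mulmxA mulmxK.
- by rewrite -rP eqmxMfull// row_full_unit unitmx_inv.
- have ne : \forall w \near z^', w != z by exact: nbhs_dnbhs_neq.
  have n2 : \forall w \near z^', T2 w \in unitmx.
    by apply: nbhs_dnbhs; exact: near_unitmx.
  have n3 : \forall w \near z^', invmx (T2 w) *m P = invmx (T2 z) *m P + (w - z) *: G1 w.
    exact: nbhs_dnbhs.
  apply: filterS3 ne n2 n3 => w wz T2w GE.
  have wz0 : w - z != 0 by rewrite subr_eq0.
  pose X := Q + (w - z)^-1 *: P.
  have TX : invmx (T2 w) *m X *m T w = 1%:M.
    have XX : X *m (Q + (w - z) *: P) = 1%:M.
      rewrite mulmxDl !mulmxDr -!scalemxAl -!scalemxAr QQ QP PQ PP.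
      by rewrite !scaler0 addr0 add0r scalerA mulVf// scale1r.
    by rewrite TT2 mulmxA -(mulmxA (invmx (T2 w)) X) XX mulmx1 mulVmx.
  have [_ Tw] := mulmx1_unit TX; split=> //.
  have -> : invmx (T w) = invmx (T2 w) *m X.
    by rewrite -[LHS]mul1mx -TX (mulmxK Tw).
  rewrite /X mulmxDr -scalemxAr GE scalerDr scalerA.
  by rewrite mulVf// scale1r addrC -addrA [G1 w + _]addrC.
Qed.

End Holomorphy.

(** * Absolutely continuous functions with vanishing derivative *)

Section AbsoluteContinuity.
Context {R : realType}.
Local Notation C := R[i].
Local Notation mu := (@lebesgue_measure R).
Implicit Types (f : R -> C).

(** The step may start before t and end after it, so that the supremum of the
    points reached is reached itself, and passed unless it is y. *)
Lemma real_induction (A : R -> Prop) (x y : R) : x <= y -> A x ->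
  (forall t, x <= t -> t <= y -> exists2 e : R, 0 < e & forall u v,
     t - e < u -> u <= t -> t <= v -> v < t + e -> x <= u -> v <= y -> A u -> A v) ->
  A y.
Proof.
move=> xy Ax step; pose S := [set t | [/\ x <= t, t <= y & A t]].
have Sx : S x by split.
have Sy : ubound S y by move=> t [].
have supS : has_sup S by split; [exists x|exists y].
have xs : x <= sup S by exact: sup_upper_bound.
have sy : sup S <= y by apply: ge_sup => //; exists x.
have [e e0 H] := step _ xs sy.
have [u [xu uy Au] eu] := sup_adherent e0 supS.
have us : u <= sup S by apply: sup_upper_bound.
have [ys|sy'] := lerP y (sup S + e / 2).
  by apply: H Au => //; lra.
have : S (sup S + e / 2).
  by split; [lra|exact: ltW|apply: H Au => //; lra].
by move/(sup_upper_bound supS); lra.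
Qed.

Lemma is_derive0_small (h : R -> R) (x e : R) : is_derive x 1 h 0 -> 0 < e ->
  exists2 d : R, 0 < d & forall t, `|t - x| < d -> `|h t - h x| <= e * `|t - x|.
Proof.
move=> [/cvg_ex[l hl] h0] e0.
have l0 : l = 0 by rewrite -h0; apply/esym/cvg_lim.
move/cvgrPdist_lt/(_ e e0): hl => /nbhs_ballP[d d0 H]; exists d => // t td.
have [->|tx] := eqVneq t x; first by rewrite !subrr normr0 mulr0.
have tx0 : t - x != 0 by rewrite subr_eq0.
have := H (t - x); rewrite /ball /= sub0r normrN => /(_ td tx0).
rewrite l0 sub0r normrN /GRing.scale /= mulr1 subrK normrM normfV.
by rewrite mulrC ltr_pdivrMr ?normr_gt0// => /ltW.
Qed.

Lemma is_cderive0_small f x (e : R) : is_cderive f x 0 -> 0 < e ->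
  exists2 d : R, 0 < d & forall t, `|t - x| < d -> normc (f t - f x) <= e * `|t - x|.
Proof.
move=> [f1 f2] e0.
have [d1 d10 H1] := is_derive0_small f1 (divr_gt0 e0 (ltr0n _ 2)).
have [d2 d20 H2] := is_derive0_small f2 (divr_gt0 e0 (ltr0n _ 2)).
exists (Num.min d1 d2); first by rewrite lt_min d10.
move=> t; rewrite lt_min => /andP[/H1 + /H2].
have := normc_leReIm (f t - f x); rewrite ReB ImB; lra.
Qed.

(** The increment of f over [x, y] is at most e (y - x), up to the increments over
    a disjoint family of intervals of total length less than d.  Walking from x to
    y, a point of the exceptional open set U is crossed by an interval contained
    in U, which is put into the family, and at any other point the derivative
    vanishes, so that a small step costs at most e times its length. *)
Lemma abs_continuous_cover f (a b x y e d : R) (U : set R) :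
  a < x -> x <= y -> y < b -> 0 < e -> open U ->
  (forall t, x <= t -> t <= y -> ~ U t -> is_cderive f t 0) ->
  (mu U < d%:E)%E ->
  exists s : seq (R * R), [/\
    forall p, p \in s -> [/\ x <= p.1, p.1 <= p.2 & p.2 <= y],
    pairwise (fun p q : R * R => q.2 <= p.1) s,
    \sum_(p <- s) (p.2 - p.1) < d &
    normc (f y - f x) <= e * (y - x) + \sum_(p <- s) normc (f p.2 - f p.1)].
Proof.
move=> ax xy yb e0 oU fU muU.
(* The lengths are compared with the measure of U up to t, because this bound
   is additive when an interval is appended. *)
pose A t := exists s : seq (R * R), [/\
    forall p, p \in s -> [/\ x <= p.1, p.1 <= p.2 & p.2 <= t],
    pairwise (fun p q : R * R => q.2 <= p.1) s,
    ((\sum_(p <- s) (p.2 - p.1))%:E <= mu (U `&` `]x, t]))%E &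
    normc (f t - f x) <= e * (t - x) + \sum_(p <- s) normc (f p.2 - f p.1)].
have mU t : measurable (U `&` `]x, t]).
  by apply: measurableI => //; exact: open_measurable.
suff [s [s1 s2 s3 s4]] : A y.
  exists s; split=> //; rewrite -lte_fin; apply: le_lt_trans s3 (le_lt_trans _ muU).
  apply: le_measure; [by apply/mem_set; exact: mU| |by move=> z []].
  by apply/mem_set; apply: open_measurable.
apply: (@real_induction A x y) => //.
  by exists [::]; split=> //; rewrite !big_nil ?subrr ?mulr0 ?addr0 ?normc0.
move=> t xt ty; have [Ut|Ut] := pselect (U t).
  have /nbhs_ballP[r r0 rU] : nbhs t U by exact: open_nbhs_nbhs.
  exists r => // u v tu ut tv vt xu vy [s [s1 s2 s3 s4]].
  have uv : u <= v by lra.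
  exists ((u, v) :: s); split=> [p|||].
  - rewrite in_cons => /predU1P[->|/s1[]]//= p1 p2 p3; split=> //.
    exact: le_trans uv.
  - by rewrite /= s2 andbT; apply/allP => p /s1[].
  - rewrite big_cons /=.
    have -> : U `&` `]x, v] = (U `&` `]x, u]) `|` `]u, v].
      apply/seteqP; split=> z /=; rewrite !in_itv /=.
        move=> [Uz /andP[xz zv]]; have [zu|uz] := lerP z u; first by left; rewrite xz.
        by right; rewrite zv.
      move=> [[Uz /andP[xz zu]]|/andP[uz zv]].
        by split=> //; rewrite xz (le_trans zu).
      split; last by rewrite zv andbT; lra.
      by apply: rU; rewrite /ball /= ltr_norml; apply/andP; split; lra.
    have -> : mu ((U `&` `]x, u]) `|` `]u, v]) = (mu (U `&` `]x, u]) + mu `]u, v]%classic)%E.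
      apply: measureU; [exact: mU|exact: measurable_itv|].
      apply/seteqP; split=> z //= [[_]]; rewrite !in_itv /= => /andP[_ zu] /andP[uz _].
      by move: uz; rewrite ltNge zu.
    rewrite EFinD addeC leeD// lebesgue_measure_itv /= lte_fin.
    case: ltP => [_|vu]; first by rewrite -EFinB.
    by rewrite lee_fin subr_le0.
  - rewrite big_cons /=.
    have := le_normcD (f v - f u) (f u - f x); rewrite addrA subrK => H.
    have : e * (u - x) <= e * (v - x) by rewrite ler_pM2l//; lra.
    lra.
have dt : is_cderive f t 0 by exact: fU.
have [r r0 H] := is_cderive0_small dt e0.
exists r => // u v tu ut tv vt xu vy [s [s1 s2 s3 s4]].
exists s; split=> // [p /s1[? ? pu]||].
- by split=> //; lra.
- apply: le_trans s3 _; apply: le_measure; [by apply/mem_set; exact: mU|by apply/mem_set; exact: mU|] => z /= [Uz].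
  rewrite !in_itv /= => /andP[-> zu]; split=> //=; lra.
- have Hv : normc (f v - f t) <= e * (v - t).
    by rewrite -[v - t]ger0_norm ?subr_ge0//; apply: H; rewrite ger0_norm; lra.
  have Hu : normc (f t - f u) <= e * (t - u).
    rewrite distcC -[t - u]ger0_norm ?subr_ge0// distrC; apply: H.
    by rewrite distrC ger0_norm; lra.
  have := le_normcD (f v - f t) (f t - f u + (f u - f x)).
  have := le_normcD (f t - f u) (f u - f x).
  have -> : f v - f t + (f t - f u + (f u - f x)) = f v - f x by ring.
  have -> : e * (v - x) = e * (v - t) + e * (t - u) + e * (u - x) by ring.
  lra.
Qed.

(** Outer regularity: a null set lies in an open set of small measure. *)
Lemma ae_open_exception (P : R -> Prop) (d : R) : {ae mu, forall t, P t} -> 0 < d ->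
  exists U : set R, [/\ open U, forall t, ~ U t -> P t & (mu U < d%:E)%E].
Proof.
move=> [N [mN N0 NP]] d0.
have Noo : (mu N < +oo)%E by rewrite N0 ltry.
have [U [oU NU muU]] := lebesgue_regularity_outer mN Noo d0.
exists U; split=> // [t Ut|].
  by apply: contrapT => nP; apply: Ut; apply: NU; exact: NP.
apply: le_lt_trans muU; rewrite -[leRHS]adde0 -[X in (_ <= _ + X)%E]N0.
have mU : measurable U by exact: open_measurable.
have {1}-> : U = (U `\` N) `|` N by rewrite setUC setDUK.
by apply: measureU2 => //; exact: measurableD.
Qed.

(** Absolute continuity makes the increments over the exceptional intervals
    negligible. *)
Lemma abs_continuous_cst f (a b x y : R) : abs_continuous f a b ->
  {ae mu, forall t, t \in `]a, b[ -> is_cderive f t 0} ->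
  a < x -> x <= y -> y < b -> f x = f y.
Proof.
move=> acf df ax xy yb.
suff H e : 0 < e -> normc (f y - f x) <= e * (y - x + 1).
  apply/esym/eqP; rewrite -subr_eq0 -normc_le0 leNgt; apply/negP => D0.
  have e0 : 0 < normc (f y - f x) / 2 / (y - x + 1) by rewrite !divr_gt0//; lra.
  have := H _ e0; rewrite divfK; last by apply: lt0r_neq0; lra.
  by lra.
move=> e0; have [d d0 Hd] := acf _ e0.
have [U [oU UP muU]] := ae_open_exception df d0.
have Ud t : x <= t -> t <= y -> ~ U t -> is_cderive f t 0.
  by move=> xt ty /UP; apply; rewrite in_itv /=; apply/andP; split; lra.
have [s [s1 s2 s3 s4]] := abs_continuous_cover ax xy yb e0 oU Ud muU.
apply: le_trans s4 _; have -> : e * (y - x + 1) = e * (y - x) + e by ring.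
rewrite lerD2l ltW//.
pose I (i : 'I_(size s)) := nth (0, 0) s i.
have := Hd (size s) I; rewrite (big_nth (0, 0)) big_mkord in s3.
rewrite [in X in _ -> X](big_nth (0, 0)) big_mkord; apply=> // [i|i k ik].
  have /s1[h1 h2 h3] : I i \in s by exact: mem_nth.
  by split; [lra|split => //; lra].
have Hp := pairwiseP (0, 0) s2.
move: ik; rewrite neq_ltn => /orP[ik|ki].
  by right; exact: (Hp i k (ltn_ord i) (ltn_ord k) ik).
by left; exact: (Hp k i (ltn_ord k) (ltn_ord i) ki).
Qed.

End AbsoluteContinuity.

(** * Products of absolutely continuous functions *)

Section EdgeEquation.
Context {R : realType}.
Local Notation C := R[i].
Local Notation mu := (@lebesgue_measure R).
Implicit Types (f g : R -> C) (w : C).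

Definition lipschitz_on f (a b K : R) : Prop := forall x y, a < x -> x <= y ->
  y < b -> normc (f y - f x) <= K * (y - x).

Definition bounded_on f (a b K : R) : Prop :=
  forall x, a < x -> x < b -> normc (f x) <= K.

(** Bounded near each point, hence on the whole segment, by induction along it. *)
Lemma continuous_bounded_itv f (a b : R) : a <= b -> continuous f ->
  exists K : R, forall x, a <= x -> x <= b -> normc (f x) <= K.
Proof.
move=> ab cf; pose A t := exists K : R, forall x, a <= x -> x <= t -> normc (f x) <= K.
apply: (@real_induction R A a b ab).
  by exists (normc (f a)) => x ax xa; have -> : x = a by lra.
move=> t at_ tb.
have : \forall s \near t, normc (f t - f s) < 1.
  have /cvgrPdist_lt/(_ 1%:C) := cf t; rewrite ltcR => /(_ ltr01).
  by apply: filterS => s; rewrite norm_normc ltcR.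
move=> /nbhs_ballP[e e0 H]; exists e => // u v tu ut tv vt au vb [K HK].
exists (Num.max K (normc (f t) + 1)) => x ax xv; rewrite le_max.
have [xu|ux] := lerP x u; first by rewrite HK.
apply/orP; right; have : normc (f t - f x) < 1.
  by apply: H; rewrite /ball /= ltr_norml; apply/andP; split; lra.
rewrite distcC; have := le_normcD (f x - f t) (f t); rewrite subrK; lra.
Qed.

Lemma lipschitz_is_cderive f f' (a b : R) : a <= b ->
  (forall x, is_cderive f x (f' x)) -> continuous f' ->
  exists K : R, lipschitz_on f a b K.
Proof.
move=> ab df cf'; have [K HK] := continuous_bounded_itv ab cf'.
have mvt (h h' : R -> R) : (forall x, is_derive x (1 : R) h (h' x)) ->
    (forall x, a <= x -> x <= b -> `|h' x| <= K) ->
    forall x y, a < x -> x < y -> y < b -> `|h y - h x| <= K * (y - x).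
  move=> dh hK x y ax xy yb.
  have ch : {within `[x, y], continuous h}.
    apply: continuous_subspaceT => z; apply/differentiable_continuous/derivable1_diffP.
    by have [] := dh z.
  have [z] := MVT xy (fun z _ => dh z) ch; rewrite in_itv /= => /andP[xz zy] ->.
  rewrite normrM [`|y - x|]ger0_norm; last lra.
  by apply: ler_wpM2r; [lra|apply: hK; lra].
exists (2 * K) => x y ax xy yb; have [->|yx] := eqVneq x y.
  by rewrite !subrr normc0 mulr0.
have {xy}yx : x < y by rewrite lt_neqAle yx.
have HR := mvt _ (fun x => complex.Re (f' x)) (fun x => (df x).1)
  (fun x ax xb => le_trans (normRe_le _) (HK x ax xb)) x y ax yx yb.
have HI := mvt _ (fun x => complex.Im (f' x)) (fun x => (df x).2)
  (fun x ax xb => le_trans (normIm_le _) (HK x ax xb)) x y ax yx yb.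
have := normc_leReIm (f y - f x); rewrite ReB ImB; lra.
Qed.

Lemma lipschitz_abs_continuous f (a b K : R) : lipschitz_on f a b K ->
  abs_continuous f a b.
Proof.
move=> lf e e0; exists (e / (`|K| + 1)); first by rewrite divr_gt0 ?ltr_wpDl.
move=> n I HI _ HS.
have := HS; rewrite ltr_pdivlMr; last by rewrite ltr_wpDl.
apply: le_lt_trans; rewrite mulr_suml; apply: ler_sum => i _.
have [aI [Ile Ib]] := HI i; apply: le_trans (lf _ _ aI Ile Ib) _.
rewrite mulrC ler_wpM2l ?subr_ge0//; have := ler_norm K; lra.
Qed.

(** Uniform continuity bounds the increment over any interval of length at most
    n d / 2 by n. *)
Lemma abs_continuous_bounded f (a b : R) : abs_continuous f a b ->
  exists K : R, bounded_on f a b K.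
Proof.
move=> acf; have [d d0 Hd] := acf 1 ltr01.
have close x y : a < x -> x <= y -> y < b -> y - x < d -> normc (f y - f x) < 1.
  move=> ax xy yb yx; have := Hd 1%N (fun=> (x, y)); rewrite !big_ord1; apply=> //.
  by move=> i k; rewrite !ord1.
have chain n x y : a < x -> x <= y -> y < b -> y - x <= n%:R * (d / 2) ->
    normc (f y - f x) <= n%:R.
  elim: n x => [|n IH] x ax xy yb yx.
    rewrite mul0r in yx; have -> : x = y by lra.
    by rewrite subrr normc0.
  have [yx'|yx'] := lerP (y - x) (d / 2).
    by apply: ltW; apply: lt_le_trans (close x y _ _ _ _) _ => //; [lra|rewrite ler1n].
  have /IH H : a < x + d / 2 by lra.
  have := close x (x + d / 2) ltac:(lra) ltac:(lra) ltac:(lra) ltac:(lra).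
  rewrite -natr1 in yx *; have := H ltac:(lra) yb ltac:(lra).
  have := le_normcD (f y - f (x + d / 2)) (f (x + d / 2) - f x).
  have -> : f y - f (x + d / 2) + (f (x + d / 2) - f x) = f y - f x by ring.
  lra.
have [ab|ba] := ltrP a b; last by exists 0 => x ax xb; lra.
pose c := (a + b) / 2; pose n := (Num.truncn ((b - a) / (d / 2))).+1.
have nd : b - a <= n%:R * (d / 2).
  by rewrite -ler_pdivrMr; [apply/ltW/truncnS_gt|lra].
exists (n%:R + normc (f c)) => x ax xb.
have ac : a < c by rewrite /c; lra.
have cb : c < b by rewrite /c; lra.
apply: le_trans (_ : normc (f x - f c) + normc (f c) <= _).
  by have := le_normcD (f x - f c) (f c); rewrite subrK.
rewrite lerD2r; have [xc|cx] := lerP x c.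
  by rewrite distcC; apply: chain => //; lra.
by apply: chain => //; lra.
Qed.

Lemma abs_continuousM f g (a b : R) : abs_continuous f a b ->
  abs_continuous g a b -> abs_continuous (fun x => f x * g x) a b.
Proof.
move=> acf acg; have [K HK] := abs_continuous_bounded acf.
have [M HM] := abs_continuous_bounded acg.
move=> e e0; pose N := `|K| + `|M| + 1.
have N0 : 0 < N by rewrite /N; have := normr_ge0 K; have := normr_ge0 M; lra.
have e'0 : 0 < e / (2 * N) by rewrite divr_gt0// mulr_gt0.
have [d1 d10 H1] := acf _ e'0; have [d2 d20 H2] := acg _ e'0.
exists (Num.min d1 d2); first by rewrite lt_min d10.
move=> n I HI dI; rewrite lt_min => /andP[/(H1 _ _ HI dI) S1 /(H2 _ _ HI dI) S2].
apply: (@le_lt_trans _ _ (N * (\sum_i normc (f (I i).2 - f (I i).1)) +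
   N * (\sum_i normc (g (I i).2 - g (I i).1)))); last first.
  have {}S1 := S1; rewrite -mulrDr mulrC -ltr_pdivlMr//.
  have -> : e / N = e / (2 * N) + e / (2 * N) by field; rewrite lt0r_neq0.
  exact: ltrD.
rewrite !mulr_sumr -big_split /=; apply: ler_sum => i _.
have [aI [Ile Ib]] := HI i.
set x := (I i).1 in aI Ile *; set y := (I i).2 in Ile Ib *.
have -> : f y * g y - f x * g x = (f y - f x) * g y + f x * (g y - g x) by ring.
apply: le_trans (le_normcD _ _) _; rewrite !normcM.
have gy : normc (g y) <= N.
  apply: le_trans (HM y _ Ib) _; first lra.
  by rewrite /N; have := ler_norm M; have := normr_ge0 K; lra.
have fx : normc (f x) <= N.
  apply: le_trans (HK x aI _) _; first lra.
  by rewrite /N; have := ler_norm K; have := normr_ge0 M; lra.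
by rewrite mulrC; apply: lerD; apply: ler_wpM2r => //; exact: normc_ge0.
Qed.

Lemma abs_continuousB f g (a b : R) : abs_continuous f a b ->
  abs_continuous g a b -> abs_continuous (fun x => f x - g x) a b.
Proof.
move=> acf acg e e0; have e2 : 0 < e / 2 by lra.
have [d1 d10 H1] := acf _ e2; have [d2 d20 H2] := acg _ e2.
exists (Num.min d1 d2); first by rewrite lt_min d10.
move=> n I HI dI; rewrite lt_min => /andP[/(H1 _ _ HI dI) S1 /(H2 _ _ HI dI) S2].
apply: (@le_lt_trans _ _ ((\sum_i normc (f (I i).2 - f (I i).1)) +
   (\sum_i normc (g (I i).2 - g (I i).1)))); last lra.
rewrite -big_split /=; apply: ler_sum => i _.
set x := (I i).1; set y := (I i).2.
have -> : f y - g y - (f x - g x) = (f y - f x) - (g y - g x) by ring.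
exact: le_normcB.
Qed.

End EdgeEquation.

(** * Solutions on one edge *)

Section EdgeSolutionSpace.
Context {R : realType}.
Local Notation C := R[i].
Local Notation mu := (@lebesgue_measure R).
Implicit Types (f g : R -> C) (w a b : C).

Lemma ae_imply (P Q : R -> Prop) : (forall t, P t -> Q t) ->
  {ae mu, forall t, P t} -> {ae mu, forall t, Q t}.
Proof.
by move=> PQ [N [mN N0 NP]]; exists N; split=> // t nQ; apply: NP => /PQ.
Qed.

Lemma ae_of_all (P : R -> Prop) : (forall t, P t) -> {ae mu, forall t, P t}.
Proof. by move=> H; exists set0; split=> // t /(_ (H t)). Qed.

(** The solution with Cauchy data a, b at the origin, and its derivative. *)
Definition edge_sol w a b (x : R) : C := a * cosw w x + b * sinw w x.
Definition edge_sol' w a b (x : R) : C := - (a * (w * sinw w x)) + b * cosw w x.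

Lemma edge_sol_cderive w a b x :
  is_cderive (edge_sol w a b) x (edge_sol' w a b x).
Proof.
apply: is_cderive_eq (is_cderiveD (is_cderiveZ a (cosw_cderive w x))
  (is_cderiveZ b (sinw_cderive w x))) _.
by rewrite /edge_sol' mulrN.
Qed.

Lemma edge_sol'_cderive w a b x :
  is_cderive (edge_sol' w a b) x (- (w * edge_sol w a b x)).
Proof.
have -> : edge_sol' w a b = fun t => (- a * w) * sinw w t + b * cosw w t.
  by apply/funext => t; rewrite /edge_sol'; ring.
apply: is_cderive_eq (is_cderiveD (is_cderiveZ _ (sinw_cderive w x))
  (is_cderiveZ b (cosw_cderive w x))) _.
by rewrite /edge_sol; ring.
Qed.

Lemma edge_sol_continuous w a b : continuous (edge_sol w a b).
Proof. by move=> x; exact: is_cderive_continuous (edge_sol_cderive w a b x). Qed.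

Lemma edge_sol'_continuous w a b : continuous (edge_sol' w a b).
Proof. by move=> x; exact: is_cderive_continuous (edge_sol'_cderive w a b x). Qed.

Lemma cderive_edge_sol w a b : cderive (edge_sol w a b) = edge_sol' w a b.
Proof. by apply/funext => x; exact: cderiveE (edge_sol_cderive w a b x). Qed.

Lemma cosw_edge_sol w x : cosw w x = edge_sol w 1 0 x.
Proof. by rewrite /edge_sol mul1r mul0r addr0. Qed.

Lemma sinw_edge_sol w x : sinw w x = edge_sol w 0 1 x.
Proof. by rewrite /edge_sol mul1r mul0r add0r. Qed.

Lemma edge_sol_abs_continuous w a b (L : R) : 0 <= L ->
  abs_continuous (edge_sol w a b) 0 L.
Proof.
move=> L0; have [K HK] := lipschitz_is_cderive L0 (edge_sol_cderive w a b)
  (@edge_sol'_continuous w a b).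
exact: lipschitz_abs_continuous HK.
Qed.

Lemma edge_sol'_abs_continuous w a b (L : R) : 0 <= L ->
  abs_continuous (edge_sol' w a b) 0 L.
Proof.
move=> L0; have c2 : continuous (fun x => - (w * edge_sol w a b x)).
  have -> : (fun x => - (w * edge_sol w a b x)) = edge_sol w (- w * a) (- w * b).
    by apply/funext => x; rewrite /edge_sol; ring.
  exact: edge_sol_continuous.
have [K HK] := lipschitz_is_cderive L0 (edge_sol'_cderive w a b) c2.
exact: lipschitz_abs_continuous HK.
Qed.

Lemma edge_sol0 w a b : edge_sol w a b 0 = a.
Proof. by rewrite /edge_sol cosw0 sinw0 mulr1 mulr0 addr0. Qed.

Lemma edge_sol'0 w a b : edge_sol' w a b 0 = b.
Proof. by rewrite /edge_sol' cosw0 sinw0 mulr1 !mulr0 oppr0 add0r. Qed.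

(** The Wronskians u and v of f with the two fundamental solutions are absolutely
    continuous and their derivatives vanish almost everywhere, so they are
    constant; since cosw^2 + w sinw^2 = 1, the function f is recovered from them as
    v cosw - u sinw. *)
Lemma edge_equation_interior f w (L : R) : 0 < L ->
  abs_continuous f 0 L -> (forall x, x \in `]0, L[ -> cderivable f x) ->
  abs_continuous (cderive f) 0 L ->
  {ae mu, forall x, x \in `]0, L[ -> is_cderive (cderive f) x (- (w * f x))} ->
  exists a b, forall x, 0 < x -> x < L ->
    f x = edge_sol w a b x /\ cderive f x = edge_sol' w a b x.
Proof.
move=> L0 acf df acf' ddf.
pose u x := f x * (- (w * sinw w x)) - cderive f x * cosw w x.
pose v x := f x * cosw w x - cderive f x * sinw w x.
have L0' := ltW L0.
have acc : abs_continuous (cosw w) 0 L.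
  by rewrite (_ : cosw w = edge_sol w 1 0); [exact: edge_sol_abs_continuous|
    apply/funext => x; rewrite cosw_edge_sol].
have acs : abs_continuous (sinw w) 0 L.
  by rewrite (_ : sinw w = edge_sol w 0 1); [exact: edge_sol_abs_continuous|
    apply/funext => x; rewrite sinw_edge_sol].
have acs' : abs_continuous (fun x => - (w * sinw w x)) 0 L.
  rewrite (_ : (fun x => _) = edge_sol w 0 (- w)); first exact: edge_sol_abs_continuous.
  by apply/funext => x; rewrite /edge_sol; ring.
have acu : abs_continuous u 0 L.
  by apply: abs_continuousB; apply: abs_continuousM.
have acv : abs_continuous v 0 L.
  by apply: abs_continuousB; apply: abs_continuousM.
have du : {ae mu, forall t, t \in `]0, L[ -> is_cderive u t 0}.
  apply: ae_imply ddf => t ddf tL; have {}ddf := ddf tL.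
  have ft := cderivableP (df t tL).
  have ds : is_cderive (fun x => - (w * sinw w x)) t (- w * cosw w t).
    under eq_fun do rewrite -mulNr.
    exact: is_cderiveZ (sinw_cderive w t).
  apply: is_cderive_eq (is_cderiveB (is_cderiveM ft ds)
    (is_cderiveM ddf (cosw_cderive w t))) _.
  by ring.
have dv : {ae mu, forall t, t \in `]0, L[ -> is_cderive v t 0}.
  apply: ae_imply ddf => t ddf tL; have {}ddf := ddf tL.
  have ft := cderivableP (df t tL).
  apply: is_cderive_eq (is_cderiveB (is_cderiveM ft (cosw_cderive w t))
    (is_cderiveM ddf (sinw_cderive w t))) _.
  by ring.
exists (v (L / 2)), (- u (L / 2)) => x x0 xL.
have cst (h : R -> C) : abs_continuous h 0 L ->
    {ae mu, forall t, t \in `]0, L[ -> is_cderive h t 0} -> h (L / 2) = h x.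
  move=> ach dh; have [xL2|L2x] := lerP x (L / 2).
    by apply/esym; apply: (abs_continuous_cst ach dh) => //; lra.
  by apply: (abs_continuous_cst ach dh) => //; lra.
rewrite (cst u acu du) (cst v acv dv) /edge_sol /edge_sol' /u /v.
have W := cosw2Dsinw2 w x.
split.
- rewrite -[LHS]mulr1 -W; ring.
- rewrite -[LHS]mulr1 -W; ring.
Qed.

Lemma cvg_right_eq f g (x L : R) : x < L ->
  (forall t, x < t -> t < L -> f t = g t) -> {for x, continuous g} ->
  f t @[t --> x^'+] --> g x.
Proof.
move=> xL fg cg; apply: cvg_trans (_ : g t @[t --> x^'+] --> g x).
  apply: near_eq_cvg; near=> t.
  by apply/esym/fg; near: t; [exact: nbhs_right_gt|exact: nbhs_right_lt].
exact: cvg_at_right_filter.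
Unshelve. all: by end_near. Qed.

Lemma cvg_left_eq f g (x L : R) : L < x ->
  (forall t, L < t -> t < x -> f t = g t) -> {for x, continuous g} ->
  f t @[t --> x^'-] --> g x.
Proof.
move=> xL fg cg; apply: cvg_trans (_ : g t @[t --> x^'-] --> g x).
  apply: near_eq_cvg; near=> t.
  by apply/esym/fg; near: t; [exact: nbhs_left_gt|exact: nbhs_left_lt].
exact: cvg_at_left_filter.
Unshelve. all: by end_near. Qed.

Lemma edge_equation f w (L : R) : 0 < L ->
  abs_continuous f 0 L -> (forall x, x \in `]0, L[ -> cderivable f x) ->
  abs_continuous (cderive f) 0 L ->
  {ae mu, forall x, x \in `]0, L[ -> is_cderive (cderive f) x (- (w * f x))} ->
  {within `[0, L], continuous f} ->
  exists a b, [/\ forall x, 0 <= x -> x <= L -> f x = edge_sol w a b x,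
    lim (cderive f x @[x --> 0^'+]) = edge_sol' w a b 0 &
    lim (cderive f x @[x --> L^'-]) = edge_sol' w a b L].
Proof.
move=> L0 acf df acf' ddf cf.
have [a [b H]] := edge_equation_interior L0 acf df acf' ddf.
exists a, b; have [_ f0 fL] := (continuous_within_itvP f L0).1 cf.
have c := @edge_sol_continuous w a b; have c' := @edge_sol'_continuous w a b.
have H1 t : 0 < t -> t < L -> f t = edge_sol w a b t by move=> t0 tL; have [] := H t t0 tL.
have H2 t : 0 < t -> t < L -> cderive f t = edge_sol' w a b t.
  by move=> t0 tL; have [] := H t t0 tL.
split.
- move=> x; rewrite le_eqVlt => /predU1P[<- _|x0].
    exact: cvg_unique f0 (cvg_right_eq L0 H1 (c _)).
  rewrite le_eqVlt => /predU1P[->|xL]; last exact: H1.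
  exact: cvg_unique fL (cvg_left_eq L0 H1 (c _)).
- apply: (cvg_lim (@norm_hausdorff _ _)); exact: cvg_right_eq L0 H2 (c' _).
- apply: (cvg_lim (@norm_hausdorff _ _)); exact: cvg_left_eq L0 H2 (c' _).
Qed.

Lemma edge_sol_lim w a b (L : R) :
  lim (cderive (edge_sol w a b) x @[x --> 0^'+]) = edge_sol' w a b 0 /\
  lim (cderive (edge_sol w a b) x @[x --> L^'-]) = edge_sol' w a b L.
Proof.
rewrite cderive_edge_sol; have c' := @edge_sol'_continuous w a b.
split; apply: (cvg_lim (@norm_hausdorff _ _)).
- exact: cvg_at_right_filter (c' _).
- exact: cvg_at_left_filter (c' _).
Qed.

Lemma edge_sol_square_integrable w a b (L : R) :
  square_integrable (edge_sol w a b) `[0, L].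
Proof.
have c := @edge_sol_continuous w a b.
have cR : continuous (fun x => complex.Re (edge_sol w a b x)).
  move=> x; exact: (@continuous_comp _ _ _ (edge_sol w a b) (@complex.Re R) x (c x) (@Re_continuous _ _)).
have cI : continuous (fun x => complex.Im (edge_sol w a b x)).
  move=> x; exact: (@continuous_comp _ _ _ (edge_sol w a b) (@complex.Im R) x (c x) (@Im_continuous _ _)).
split.
- by apply: measurable_funTS; exact: continuous_measurable_fun.
- by apply: measurable_funTS; exact: continuous_measurable_fun.
have nE : (fun x => normc (edge_sol w a b x) ^+ 2) = fun x =>
    complex.Re (edge_sol w a b x) ^+ 2 + complex.Im (edge_sol w a b x) ^+ 2.
  apply/funext => x; case: (edge_sol w a b x) => p q /=.
  by rewrite sqr_sqrtr// addr_ge0 ?sqr_ge0.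
have ci : mu.-integrable `[0, L] (EFin \o (fun x => normc (edge_sol w a b x) ^+ 2)).
  apply: continuous_compact_integrable; first exact: segment_compact.
  apply: continuous_subspaceT; rewrite nE => x.
  by apply: cvgD; apply: cvgM; [exact: cR|exact: cR|exact: cI|exact: cI].
have /integrableP[_] := ci; apply: le_lt_trans.
apply: ge0_le_integral => //.
- by move=> x _; rewrite lee_fin sqr_ge0.
- by case/integrableP: ci.
- by apply: measurableT_comp => //; case/integrableP: ci.
- by move=> x _ /=; rewrite lee_fin ler_norm.
Qed.

(** A property true almost everywhere is true on a dense set, since an interval
    has positive measure. *)
Lemma ae_dense (P : R -> Prop) (x d : R) : {ae mu, forall t, P t} -> 0 < d ->
  exists2 s, P s & `|s - x| < d.
Proof.
move=> [N [mN N0 NP]] d0; apply: contrapT => nP.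
have xd : x - d < x + d by rewrite ltrBlDr -addrA ltrDl addr_gt0.
have : (mu `](x - d)%R, (x + d)%R[%classic <= mu N)%E.
  apply: le_measure; [by apply/mem_set; exact: measurable_itv|exact/mem_set|].
  move=> s /=; rewrite in_itv /= => /andP[xs sx]; apply: NP => /= Ps.
  apply: nP; exists s => //; rewrite ltr_norml ltrBrDr addrC xs /=.
  by rewrite ltrBlDr addrC.
rewrite N0 lebesgue_measure_itv /= lte_fin xd -EFinB lee_fin.
by rewrite subr_le0 leNgt xd.
Qed.

(** The matrix of the Cauchy data of cosw and sinw at x has determinant 1. *)
Lemma edge_sol_cauchy w a b (x : R) : edge_sol w a b x = 0 ->
  edge_sol' w a b x = 0 -> a = 0 /\ b = 0.
Proof.
have W := cosw2Dsinw2 w x; rewrite /edge_sol /edge_sol'.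
set p := cosw _ _ in W *; set q := sinw _ _ in W * => H H'.
split.
- rewrite -[a]mulr1 -W.
  have -> : a * (p ^+ 2 + w * q ^+ 2)
    = p * (a * p + b * q) - q * (- (a * (w * q)) + b * p) by ring.
  by rewrite H H' !mulr0 subr0.
- rewrite -[b]mulr1 -W.
  have -> : b * (p ^+ 2 + w * q ^+ 2)
    = w * q * (a * p + b * q) + p * (- (a * (w * q)) + b * p) by ring.
  by rewrite H H' !mulr0 addr0.
Qed.

Lemma edge_sol_eq0 w a b (L : R) : 0 < L ->
  (forall x, 0 < x -> x < L -> edge_sol w a b x = 0) -> a = 0 /\ b = 0.
Proof.
move=> L0 z.
have H : edge_sol w a b (L / 2) = 0 by apply: z; lra.
apply: (edge_sol_cauchy H).
apply: is_cderive_unique (edge_sol_cderive w a b (L / 2)) _.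
apply: is_cderive_near (is_cderive_cst 0 _); near=> t.
by apply/esym/z; near: t; [apply: lt_nbhsr|apply: lt_nbhsl]; lra.
Unshelve. all: by end_near. Qed.

Lemma edge_sol_ae0 w a b (L : R) : 0 < L ->
  {ae mu, forall x, x \in `[0, L] -> edge_sol w a b x = 0} -> a = 0 /\ b = 0.
Proof.
move=> L0 ae0; have c := @edge_sol_continuous w a b.
apply: (edge_sol_eq0 L0) => x x0 xL; apply/eqP; apply/negPn/negP => fx.
have : \forall s \near x, edge_sol w a b s != 0.
  have /cvgrPdist_lt/(_ (normc (edge_sol w a b x))%:C) := c x.
  rewrite ltcR normc_gt0 => /(_ fx); apply: filterS => s.
  by apply: contraTneq => ->; rewrite subr0 norm_normc ltcR ltxx.
move=> /nbhs_ballP[e e0 H].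
pose d := Num.min e (Num.min x (L - x)).
have d0 : 0 < d by rewrite !lt_min e0 x0 subr_gt0.
have [de [dx dL]] : d <= e /\ d <= x /\ d <= L - x.
  by have : d <= d by []; rewrite {2}/d !le_min => /and3P[].
have [s fs0] := ae_dense x ae0 d0; rewrite ltr_norml => /andP[s1 s2].
have /H/eqP : ball x e s by rewrite /ball /= ltr_norml; apply/andP; split; lra.
by apply; apply: fs0; rewrite in_itv /=; apply/andP; split; lra.
Qed.

End EdgeSolutionSpace.

(** * Dirichlet eigenvalues of an edge, and cycles *)

Section SineZeros.
Context {R : realType}.
Local Notation C := R[i].

(** The Wronskians of h with cosw and sinw are constant. *)
Lemma sinw_unique (w : C) (h h' : R -> C) : (forall x, is_cderive h x (h' x)) ->
  (forall x, is_cderive h' x (- (w * h x))) -> h 0 = 0 -> h' 0 = 1 ->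
  h =1 sinw w.
Proof.
move=> dh dh' h0 h'0 x.
pose u x := h x * (w * sinw w x) + h' x * cosw w x.
pose v x := h x * cosw w x - h' x * sinw w x.
have ux : u x = 1.
  suff -> : u x = u 0 by rewrite /u h0 h'0 cosw0 mul0r add0r mul1r.
  apply: is_cderive_0_is_cst => t.
  apply: is_cderive_eq (is_cderiveD (is_cderiveM (dh t)
    (is_cderiveZ w (sinw_cderive w t))) (is_cderiveM (dh' t) (cosw_cderive w t))) _.
  by ring.
have vx : v x = 0.
  suff -> : v x = v 0 by rewrite /v h0 sinw0 mul0r mulr0 subr0.
  apply: is_cderive_0_is_cst => t.
  apply: is_cderive_eq (is_cderiveB (is_cderiveM (dh t) (cosw_cderive w t))
    (is_cderiveM (dh' t) (sinw_cderive w t))) _.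
  by ring.
rewrite -[LHS]mulr1 -(cosw2Dsinw2 w x).
have -> : h x * (cosw w x ^+ 2 + w * sinw w x ^+ 2)
  = v x * cosw w x + u x * sinw w x by rewrite /u /v; ring.
by rewrite ux vx mul0r mul1r add0r.
Qed.

Lemma is_cderive_real (h : R -> R) (x d : R) : is_derive x 1 h d ->
  is_cderive (fun t => (h t)%:C) x d%:C.
Proof. by split => //=; exact: is_derive_cst. Qed.

Lemma is_derive_scale (h : R -> R) (k x d : R) : is_derive (k * x) 1 h d ->
  is_derive x 1 (fun t => h (k * t)) (k * d).
Proof.
move=> dh; have dk : is_derive x 1 (fun t => k * t) k.
  by apply: is_derive_eq; rewrite /GRing.scale /=; ring.
have := is_derive1_comp dh dk; rewrite mulrC; exact.
Qed.

Lemma sinw_pos (k x : R) : k != 0 -> sinw (k ^+ 2)%:C x = (sin (k * x) / k)%:C.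
Proof.
move=> k0; apply/esym.
apply: (@sinw_unique _ (fun t => (sin (k * t) / k)%:C) (fun t => (cos (k * t))%:C)).
- move=> t; apply: is_cderive_real.
  have ds := is_derive_scale (is_derive_sin (k * t)).
  by apply: is_derive_eq; rewrite /GRing.scale /=; field.
- move=> t; apply: is_cderive_eq (is_cderive_real (is_derive_scale (is_derive_cos (k * t)))) _.
  by rewrite -!rmorphM -rmorphN; congr (_%:C); field.
- by rewrite mulr0 sin0 mul0r.
- by rewrite mulr0 cos0.
Qed.

Lemma sinw_neg (k x : R) : k != 0 ->
  sinw (- k ^+ 2)%:C x = ((expR (k * x) - expR (- k * x)) / (2 * k))%:C.
Proof.
move=> k0; apply/esym.
apply: (@sinw_unique _ (fun t => ((expR (k * t) - expR (- k * t)) / (2 * k))%:C)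
  (fun t => ((expR (k * t) + expR (- k * t)) / 2)%:C)).
- move=> t; apply: is_cderive_real.
  have d1 := is_derive_scale (is_derive_expR (k * t)).
  have d2 := is_derive_scale (is_derive_expR (- k * t)).
  by apply: is_derive_eq; rewrite /GRing.scale /=; field.
- move=> t; rewrite -rmorphM -rmorphN; apply: is_cderive_real.
  have d1 := is_derive_scale (is_derive_expR (k * t)).
  have d2 := is_derive_scale (is_derive_expR (- k * t)).
  by apply: is_derive_eq; rewrite /GRing.scale /=; field.
- by rewrite !mulr0 subrr mul0r.
- by rewrite !mulr0 expR0 -[X in X / _]/(2%:R) divff.
Qed.

Lemma sin_eq0_nat (x : R) : 0 <= x -> sin x = 0 -> exists n : nat, x = n%:R * pi.
Proof.
move=> x0 sx; have [m xm] : exists m : nat, x < m.+1%:R * pi.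
  exists (Num.truncn (x / pi)); rewrite -ltr_pdivrMr ?pi_gt0//; exact: truncnS_gt.
have base y : 0 <= y -> sin y = 0 -> y < pi -> y = 0.
  move=> y0 sy yp; apply/eqP; rewrite eq_le y0 andbT leNgt; apply/negP => y0'.
  by have := @sin_gt0_pi _ y; rewrite sy ltxx y0' yp => /(_ isT).
elim: m x x0 sx xm => [|m IH] x x0 sx xm.
  by exists 0%N; rewrite mul0r; apply: base => //; rewrite mul1r in xm.
have [xp|px] := ltrP x pi; first by exists 0%N; rewrite mul0r; exact: base.
have [|||n nE] := IH (x - pi).
- lra.
- by rewrite -[x](subrK pi) sinDpi in sx; apply/eqP; rewrite -oppr_eq0 sx.
- by rewrite -natr1 mulrDl mul1r in xm; lra.
by exists n.+1; rewrite -natr1 mulrDl mul1r -nE subrK.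
Qed.

(** For lambda < 0 the solution is a hyperbolic sine and for lambda = 0 it is x;
    neither vanishes at a positive point. *)
Lemma sinw_eq0 (lambda L : R) : 0 < L -> sinw lambda%:C L = 0 ->
  exists n : nat, (n != 0)%N /\ Num.sqrt lambda * L = n%:R * pi.
Proof.
move=> L0; have [l0|l0|->] := ltgtP lambda 0.
- pose k := Num.sqrt (- lambda); have k0 : 0 < k by rewrite sqrtr_gt0 oppr_gt0.
  have -> : lambda = - k ^+ 2 by rewrite sqr_sqrtr ?opprK// oppr_ge0 ltW.
  rewrite sinw_neg ?lt0r_neq0// => /complexI /eqP.
  rewrite mulf_eq0 invr_eq0 mulf_eq0 pnatr_eq0 (negbTE (lt0r_neq0 k0)) !orbF.
  rewrite subr_eq0 => /eqP /expR_inj E; have := mulr_gt0 k0 L0; lra.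
- pose k := Num.sqrt lambda; have k0 : 0 < k by rewrite sqrtr_gt0.
  have {1}-> : lambda = k ^+ 2 by rewrite sqr_sqrtr// ltW.
  rewrite sinw_pos ?lt0r_neq0// => /complexI /eqP.
  rewrite mulf_eq0 invr_eq0 (negbTE (lt0r_neq0 k0)) orbF => /eqP.
  move=> /(sin_eq0_nat (ltW (mulr_gt0 k0 L0)))[n nE]; exists n; split=> //.
  apply: contraTneq (mulr_gt0 k0 L0) => n0.
  by rewrite nE n0 mul0r ltxx.
- by rewrite /sinw mul0r Phi0 (erefl : 1`! = 1)%N invr1 mulr1 => /complexI L0'; rewrite L0' ltxx in L0.
Qed.

(** Both lengths are nonzero integer multiples of pi / sqrt(lambda). *)
Lemma sinw_eq0_rational (lambda L L' : R) : 0 < L -> 0 < L' ->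
  sinw lambda%:C L = 0 -> sinw lambda%:C L' = 0 -> ~ rationally_independent L L'.
Proof.
move=> L0 L'0 /(sinw_eq0 L0)[n [n0 nE]] /(sinw_eq0 L'0)[m [m0 mE]]; apply.
have mR : (m%:R : R) != 0 by rewrite pnatr_eq0.
have nR : (n%:R : R) != 0 by rewrite pnatr_eq0.
have pR : (pi : R) != 0 by rewrite lt0r_neq0// pi_gt0.
have k0 : Num.sqrt lambda != 0.
  apply/eqP => k0; move: nE; rewrite k0 mul0r => /esym/eqP.
  by rewrite mulf_eq0 (negbTE nR) (negbTE pR).
exists (n%:R / m%:R); rewrite rmorph_div /= ?ratr_nat; last first.
  by rewrite unitfE pnatr_eq0.
have -> : L = n%:R * pi / Num.sqrt lambda by rewrite -nE mulrC mulKf.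
have -> : L' = m%:R * pi / Num.sqrt lambda by rewrite -mE mulrC mulKf.
move: (pi : R) pR => p pR.
by field; rewrite k0 mR pR.
Qed.

End SineZeros.

Section Cycles.
Context {R : realType} {r s : nat} (G : metric_graph R r s).
Local Notation D := ('I_r * bool)%type.

Definition opposite (d : D) : D := (d.1, ~~ d.2).

Lemma next_dart (F : {set 'I_r}) (d : D) : no_degree_one G F -> d.1 \in F ->
  exists d' : D, [/\ d'.1 \in F, source G d' = target G d & d' <> opposite d].
Proof.
move=> /forallP/(_ (target G d)) nF dF.
set A := [set p : D | (p.1 \in F) && (vert G p == target G d)]%SET.
have dA : opposite d \in A by rewrite finset.inE dF eqxx.
have [A1|/pred0Pn[d' /andP[d'A d'o]]] := boolP (pred0b [pred p | (p \in A) && (p != opposite d)]).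
  case/negP: nF; apply/cards1P; exists (opposite d).
  apply/finset.setP => p; rewrite !finset.inE; apply/idP/eqP => [pA|->]; last first.
    by rewrite dF eqxx.
  have /pred0P/(_ p)/= := A1; rewrite finset.inE pA /= => /negbT.
  by rewrite negbK => /eqP.
move: d'A; rewrite finset.inE => /andP[d'F /eqP d's]; exists d'; split=> //.
exact/eqP.
Qed.

(** Starting in F one can walk forever without turning back on an edge, as no
    vertex has degree one in F.  The walk between the first repeated vertex and its
    previous visit is a cycle: two of its darts on the same edge would be equal,
    hence have the same source, or opposite, and then they are consecutive since the
    sources are distinct, contradicting that the walk never turns back. *)
Lemma exists_cycle (F : {set 'I_r}) (j : 'I_r) : no_degree_one G F -> j \in F ->
  exists2 c, is_cycle G c & forall k, k \in [seq d.1 | d <- c] -> k \in F.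
Proof.
move=> nF jF.
have /choice[nx nxP] : forall d : D, exists d' : D, d.1 \in F ->
    [/\ d'.1 \in F, source G d' = target G d & d' <> opposite d].
  move=> d; have [dF|] := boolP (d.1 \in F); last by exists d.
  by have [d' H] := next_dart nF dF; exists d'.
pose walk k := iter k nx (j, false).
have wF k : (walk k).1 \in F by elim: k => //= k /nxP[].
have wS k : source G (walk k.+1) = target G (walk k) by have [] := nxP _ (wF k).
have wO k : walk k.+1 <> opposite (walk k) by have [] := nxP _ (wF k).
pose S i n := [seq source G (walk k) | k <- iota i n].
have [m mN minm] : exists2 m, ~~ uniq (S 0%N m) & forall n, ~~ uniq (S 0%N n) -> (m <= n)%N.
  have exN : exists n, ~~ uniq (S 0%N n).
    exists s.+1; apply/negP => /card_uniqP cS.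
    have := max_card (mem (S 0%N s.+1)); rewrite cS size_map size_iota card_ord.
    by rewrite ltnn.
  by case: (ex_minnP exN) => m mN minm; exists m.
case: m mN minm => [//|n] nN minn.
have un : uniq (S 0%N n) by apply/negPn/negP => /minn; rewrite ltnn.
have Sn k : (k < n)%N -> nth (source G (walk 0)) (S 0%N n) k = source G (walk k).
  by move=> kn; rewrite (nth_map 0%N) ?size_iota// nth_iota.
have sinj k l : (k < n)%N -> (l < n)%N -> source G (walk k) = source G (walk l) -> k = l.
  move=> kn ln E; apply/eqP.
  rewrite -(nth_uniq (source G (walk 0)) _ _ un) ?size_map ?size_iota// !Sn//.
  exact/eqP.
have /mapP[i i_n] : source G (walk n) \in [seq source G (walk k) | k <- iota 0 n].
  by move: nN; rewrite /S -addn1 iotaD map_cat cat_uniq /= un orbF andbT negbK add0n.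
move: i_n; rewrite mem_iota add0n => /andP[_ i_n] Ein.
have mlen : (0 < n - i)%N by rewrite subn_gt0.
exists [seq walk k | k <- iota i (n - i)]; last first.
  by move=> k /mapP[d /mapP[l _ ->] ->]; exact: wF.
have memI k : k \in iota i (n - i) -> (i <= k < n)%N by rewrite mem_iota subnKC// ltnW.
have einj k l : (k < l)%N -> (l < n)%N -> (walk k).1 <> (walk l).1.
  move=> kl ln E; have kn := ltn_trans kl ln.
  have [E2|E2] := eqVneq (walk l).2 (walk k).2.
    have : walk k = walk l by apply/eqP; rewrite -pair_eqE /pair_eq /= E E2 !eqxx.
    by move=> /(congr1 (source G))/(sinj _ _ kn ln) kl'; rewrite kl' ltnn in kl.
  have lo : walk l = opposite (walk k).
    apply/eqP; rewrite -pair_eqE /pair_eq /= E eqxx /=.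
    by move: E2; case: (walk l).2; case: (walk k).2.
  have : source G (walk l) = source G (walk k.+1) by rewrite wS lo.
  move=> /(sinj _ _ ln (leq_ltn_trans kl ln)) lk; rewrite lk in lo.
  exact: wO lo.
apply/and4P; split.
- by rewrite -size_eq0 size_map size_iota -lt0n.
- have wpath k m : path [rel d d' | target G d == source G d'] (walk k)
    [seq walk k | k <- iota k.+1 m].
    by elim: m k => //= m IH k; rewrite wS eqxx; exact: IH.
  case E : (n - i)%N mlen => [//|m] _ /=; rewrite rcons_path wpath /=.
  have -> : last (walk i) [seq walk k | k <- iota i.+1 m] = walk (i + m)%N.
    rewrite last_map; congr walk; case: m E => [|m] E; first by rewrite addn0.
    by rewrite -nth_last size_iota nth_iota// addSn addnS.
  rewrite -wS -Ein; have -> // : (i + m).+1 = n by rewrite -addnS -E subnKC// ltnW.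
- rewrite -map_comp map_inj_in_uniq ?iota_uniq// => k l /memI/andP[_ kn] /memI/andP[_ ln] /= E.
  by case: (ltngtP k l) => // kl; [have := einj k l kl ln E|have := einj l k kl kn (esym E)].
- rewrite -map_comp map_inj_in_uniq ?iota_uniq// => k l /memI/andP[_ kn] /memI/andP[_ ln] /= E.
  exact: sinj.
Qed.

End Cycles.

(** * The vertex conditions as linear equations *)

Section VertexEquations.
Context {R : realType} {r s : nat} (G : metric_graph R r s) (alpha : 'I_s -> R).
Local Notation C := R[i].
Local Notation D := ('I_r * bool)%type.
Local Notation unknown := ('I_r * bool + 'I_s)%type.
Implicit Types (u v : unknown -> C) (w z : C) (p q : D).

(** The unknowns are the Cauchy data at 0 of the solution on each edge, indexed
    by the darts (j, false) and (j, true), and the values at the vertices.  There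
    is one equation for each dart (continuity) and for each vertex (the condition on
    the derivatives), so that the system is square.  Unlike a reduction to the
    vertex values alone, it has no singularity at the Dirichlet eigenvalues of
    the edges. *)
Definition endpoint p : R := if p.2 then len G p.1 else 0.

Definition val_at w u p : C :=
  edge_sol w (u (inl (p.1, false))) (u (inl (p.1, true))) (endpoint p).

(** The derivative along the outward direction at the end p of an edge. *)
Definition out_at w u p : C :=
  (-1) ^+ (~~ p.2) * edge_sol' w (u (inl (p.1, false))) (u (inl (p.1, true))) (endpoint p).

Definition eqn w u (k : unknown) : C := match k with
  | inl p => val_at w u p - u (inr (vert G p))
  | inr v => \sum_(p | vert G p == v) out_at w u p - (alpha v)%:C * u (inr v)
  end.

(** The same quantities differentiated with respect to w. *)
Definition dedge_sol w a b (x : R) : C := a * dcosw w x + b * dsinw w x.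
Definition dedge_sol' w a b (x : R) : C :=
  - (a * (sinw w x + w * dsinw w x)) + b * dcosw w x.

Definition dval_at w u p : C :=
  dedge_sol w (u (inl (p.1, false))) (u (inl (p.1, true))) (endpoint p).

Definition dout_at w u p : C :=
  (-1) ^+ (~~ p.2) * dedge_sol' w (u (inl (p.1, false))) (u (inl (p.1, true))) (endpoint p).

Definition deqn w u (k : unknown) : C := match k with
  | inl p => dval_at w u p
  | inr v => \sum_(p | vert G p == v) dout_at w u p
  end.

Lemma eqn_linear w c u v k :
  eqn w (fun i => c * u i + v i) k = c * eqn w u k + eqn w v k.
Proof.
case: k => [p|x] /=.
  by rewrite /val_at /edge_sol; ring.
have -> : \sum_(p | vert G p == x) out_at w (fun i => c * u i + v i) p
  = c * \sum_(p | vert G p == x) out_at w u p + \sum_(p | vert G p == x) out_at w v p.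
  rewrite mulr_sumr -big_split /=; apply: eq_bigr => p _.
  by rewrite /out_at /edge_sol'; ring.
ring.
Qed.

Lemma deqn_linear w c u v k :
  deqn w (fun i => c * u i + v i) k = c * deqn w u k + deqn w v k.
Proof.
case: k => [p|x] /=.
  by rewrite /dval_at /dedge_sol; ring.
rewrite mulr_sumr -big_split /=; apply: eq_bigr => p _.
by rewrite /dout_at /dedge_sol'; ring.
Qed.

Lemma sum_darts (X : D -> C) : \sum_p X p = \sum_j (X (j, true) + X (j, false)).
Proof.
rewrite (eq_bigr (fun p : D => X (p.1, p.2))); last by case.
rewrite -(pair_bigA _ (fun j b => X (j, b))) /=; apply: eq_bigr => j _.
by rewrite big_bool.
Qed.

Lemma sum_vertices (X : D -> C) : \sum_p X p = \sum_v \sum_(p | vert G p == v) X p.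
Proof. exact: (partition_big (vert G) predT). Qed.

Lemma edge_zero_end w u p : val_at w u p = 0 -> out_at w u p = 0 ->
  u (inl (p.1, false)) = 0 /\ u (inl (p.1, true)) = 0.
Proof.
move=> vp op; apply: (edge_sol_cauchy vp); apply/eqP.
by move/eqP: op; rewrite /out_at mulf_eq0 signr_eq0.
Qed.

Lemma dedge_sol_cderive w a b x : is_cderive (dedge_sol w a b) x (dedge_sol' w a b x).
Proof.
apply: is_cderive_eq (is_cderiveD (is_cderiveZ a (dcosw_cderive w x))
  (is_cderiveZ b (dsinw_cderive w x))) _.
by rewrite /dedge_sol'; ring.
Qed.

Lemma dedge_sol'_cderive w a b x : is_cderive (dedge_sol' w a b) x
  (- (w * dedge_sol w a b x + edge_sol w a b x)).
Proof.
have -> : dedge_sol' w a b = fun t => (- a) * (sinw w t + w * dsinw w t) + b * dcosw w t.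
  by apply/funext => t; rewrite /dedge_sol'; ring.
apply: is_cderive_eq (is_cderiveD (is_cderiveZ _ (is_cderiveD (sinw_cderive w x)
  (is_cderiveZ w (dsinw_cderive w x)))) (is_cderiveZ b (dcosw_cderive w x))) _.
by rewrite /dedge_sol /edge_sol; ring.
Qed.

Lemma conjc_scale (a : R) z : conjc (a%:C * z) = a%:C * conjc z.
Proof. by case: z => x y; apply: complex_ext => /=; ring. Qed.

Lemma conjc_scaleN (a : R) z : conjc (- (a%:C * z)) = - (a%:C * conjc z).
Proof. by case: z => x y; apply: complex_ext => /=; ring. Qed.

(** For - F'' = lambda F + f and - f'' = lambda f with lambda real, the Wronskian W
    of F and the conjugate of f satisfies W' = - |f|^2.  Monotonicity of its real
    part replaces the integral of |f|^2. *)
Lemma lagrange_edge (lambda : R) (f f' F F' : R -> C) (L : R) : 0 < L ->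
  (forall x, is_cderive f x (f' x)) -> (forall x, is_cderive f' x (- (lambda%:C * f x))) ->
  (forall x, is_cderive F x (F' x)) ->
  (forall x, is_cderive F' x (- (lambda%:C * F x + f x))) ->
  let W x := F' x * conjc (f x) - F x * conjc (f' x) in
  complex.Re (W L - W 0) <= 0 /\
  (complex.Re (W L - W 0) = 0 -> forall x, 0 < x -> x < L -> f x = 0).
Proof.
move=> L0 df df' dF dF' W.
have dW (x : R) : is_derive x (1 : R) (fun t => complex.Re (W t)) (- normc (f x) ^+ 2).
  have : is_cderive W x (- (f x * conjc (f x))).
    apply: is_cderive_eq (is_cderiveB (is_cderiveM (dF' x) (is_cderive_conj (df x)))
      (is_cderiveM (dF x) (is_cderive_conj (df' x)))) _.
    by rewrite conjc_scaleN; ring.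
  move=> [+ _]; congr (is_derive _ _ _ _); case: (f x) => p q /=.
  by rewrite sqr_sqrtr ?addr_ge0 ?sqr_ge0//; ring.
have mono (x y : R) : x <= y -> complex.Re (W y) <= complex.Re (W x).
  rewrite le_eqVlt => /predU1P[->//|xy].
  have cW : {within `[x, y], continuous (fun t => complex.Re (W t))}.
    apply: continuous_subspaceT => t; apply/differentiable_continuous/derivable1_diffP.
    by have [] := dW t.
  have [c _ E] := MVT xy (fun t _ => dW t) cW.
  rewrite -subr_le0 E mulNr oppr_le0 mulr_ge0 ?sqr_ge0// subr_ge0; exact: ltW.
rewrite ReB subr_le0; split; first exact/mono/ltW.
move=> /eqP; rewrite subr_eq0 => /eqP WE x x0 xL.
have cst (t : R) : 0 <= t -> t <= L -> complex.Re (W t) = complex.Re (W 0).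
  by move=> t0 tL; have := mono _ _ t0; have := mono _ _ tL; rewrite WE; lra.
have d0 : is_derive x (1 : R) (fun t => complex.Re (W t)) 0.
  apply: (near_eq_is_derive (f := fun=> complex.Re (W 0))) => //.
  near=> t; apply/esym/cst; apply: ltW; near: t; [exact: lt_nbhsr|exact: lt_nbhsl].
have := @derive_val _ _ _ _ _ _ _ (dW x); rewrite (@derive_val _ _ _ _ _ _ _ d0).
move=> /eqP; rewrite eq_sym oppr_eq0 sqrf_eq0 => /eqP; exact: eq0_normc.
Unshelve. all: by end_near. Qed.

(** Selfadjointness.  If u is in the kernel and the derivative of the system
    in direction u is in its range, then the corresponding function F satisfies
    - F'' = lambda F + f and the vertex conditions.  By these conditions the boundary
    terms of the Lagrange identities cancel at each vertex; being of the same
    sign on all edges, the increments of the Wronskians vanish and so does f. *)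
Lemma no_jordan_chain (lambda : R) u v : (forall k, eqn lambda%:C u k = 0) ->
  (forall k, deqn lambda%:C u k + eqn lambda%:C v k = 0) -> forall i, u i = 0.
Proof.
move=> Hu Hv; set w := lambda%:C in Hu Hv.
pose f j := edge_sol w (u (inl (j, false))) (u (inl (j, true))).
pose f' j := edge_sol' w (u (inl (j, false))) (u (inl (j, true))).
pose F j x := dedge_sol w (u (inl (j, false))) (u (inl (j, true))) x
  + edge_sol w (v (inl (j, false))) (v (inl (j, true))) x.
pose F' j x := dedge_sol' w (u (inl (j, false))) (u (inl (j, true))) x
  + edge_sol' w (v (inl (j, false))) (v (inl (j, true))) x.
pose W j x := F' j x * conjc (f j x) - F j x * conjc (f' j x).
have lag j := @lagrange_edge lambda (f j) (f' j) (F j) (F' j) (len G j) (len_gt0 G j)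
  (edge_sol_cderive _ _ _) (edge_sol'_cderive _ _ _)
  (fun x => is_cderiveD (dedge_sol_cderive _ _ _ x) (edge_sol_cderive _ _ _ x)).
have {}lag j : complex.Re (W j (len G j) - W j 0) <= 0 /\
    (complex.Re (W j (len G j) - W j 0) = 0 -> forall x, 0 < x -> x < len G j -> f j x = 0).
  apply: lag => x; apply: is_cderive_eq (is_cderiveD (dedge_sol'_cderive _ _ _ x)
    (edge_sol'_cderive _ _ _ x)) _.
  by rewrite /F /f; ring.
have fv p : val_at w u p = u (inr (vert G p)).
  by have /eqP := Hu (inl p); rewrite subr_eq0 => /eqP.
have Fv p : dval_at w u p + val_at w v p = v (inr (vert G p)).
  by have /eqP := Hv (inl p); rewrite /= addrA subr_eq0 => /eqP.
have fo x : \sum_(p | vert G p == x) out_at w u p = (alpha x)%:C * u (inr x).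
  by have /eqP := Hu (inr x); rewrite subr_eq0 => /eqP.
have Fo x : \sum_(p | vert G p == x) (dout_at w u p + out_at w v p)
    = (alpha x)%:C * v (inr x).
  by have /eqP := Hv (inr x); rewrite /= addrA subr_eq0 -big_split /= => /eqP.
have W0 : \sum_j (W j (len G j) - W j 0) = 0.
  have alg (P A0 A1 F0 g h : C) : P - ((A0 + A1) * g - F0 * conjc h)
      = P + ((- A0 + - A1) * g - F0 * conjc (- h) ).
    by rewrite rmorphN; ring.
  pose X p := (dout_at w u p + out_at w v p) * conjc (val_at w u p)
    - (dval_at w u p + val_at w v p) * conjc (out_at w u p).
  transitivity (\sum_p X p).
    rewrite sum_darts; apply: eq_bigr => j _.
    rewrite /X /W /dout_at /out_at /val_at /dval_at /= /endpoint /= !expr0 !expr1.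
    rewrite !mul1r !mulN1r; exact: alg.
  rewrite sum_vertices big1// => x _.
  have -> : \sum_(p | vert G p == x) X p
    = (\sum_(p | vert G p == x) (dout_at w u p + out_at w v p)) * conjc (u (inr x))
      - v (inr x) * conjc (\sum_(p | vert G p == x) out_at w u p).
    rewrite rmorph_sum /= mulr_suml mulr_sumr -sumrB; apply: eq_bigr => p /eqP px.
    by rewrite /X fv Fv px.
  by rewrite fo Fo conjc_scale; ring.
have Wj j : complex.Re (W j (len G j) - W j 0) = 0.
  have : \sum_j - complex.Re (W j (len G j) - W j 0) == 0.
    rewrite sumrN oppr_eq0; have := congr1 (@complex.Re R) W0.
    by rewrite (big_morph (@complex.Re R) (@ReD R) (erefl : complex.Re 0 = 0)) => ->.
  rewrite psumr_eq0 => [/allP/(_ j (mem_index_enum _))/=|k _].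
    by rewrite oppr_eq0 => /eqP.
  by rewrite oppr_ge0; have [] := lag k.
have zero j : u (inl (j, false)) = 0 /\ u (inl (j, true)) = 0.
  by apply: (edge_sol_eq0 (len_gt0 G j)); have [_] := lag j; apply.
move=> [[j []]|x]; [by have [] := zero j|by have [] := zero j|].
have [p px] := vert_surj G x; rewrite -px -fv /val_at /edge_sol.
by have [-> ->] := zero p.1; rewrite !mul0r addr0.
Qed.

End VertexEquations.

(** * Unique continuation from the selected vertices *)

Section Kernels.
Context {R : realType} {r s : nat} (G : metric_graph R r s) (alpha : 'I_s -> R).
Local Notation C := R[i].
Local Notation D := ('I_r * bool)%type.
Local Notation unknown := ('I_r * bool + 'I_s)%type.
Variable (B : {set 'I_s}).
Hypothesis B_boundary : forall v, boundary_vertex G v -> v \in B.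
Hypothesis B_core : forall v, proper_core_vertex G v -> v \in B.
Hypothesis cycles : forall c, is_cycle G c ->
     exists j k, [/\ j \in [seq d.1 | d <- c], k \in [seq d.1 | d <- c] &
       rationally_independent (len G j) (len G k)].

(** Let F be the set of edges on which the eigenfunction does not vanish.  At a
    vertex of degree one in F the function vanishes, by continuity if another edge
    is attached there and by hypothesis if the vertex is a boundary vertex; all
    other outward derivatives vanish, so the remaining one does, and the function
    vanishes on the edge.  Hence F has no vertex of degree one and lies in the
    core.  A vertex that is not a proper core vertex meets an edge outside F, so the
    function vanishes at all vertices, and each edge of F has lambda as a
    Dirichlet eigenvalue; along a cycle of F all lengths would be commensurable. *)
Lemma unique_continuation (lambda : R) (u : unknown -> C) :
  (forall k, eqn G alpha lambda%:C u k = 0) ->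
  (forall v, v \in B -> u (inr v) = 0) -> forall i, u i = 0.
Proof.
move=> Hu HB; set w := lambda%:C in Hu.
pose F := [set j | (u (inl (j, false)) != 0) || (u (inl (j, true)) != 0)]%SET.
have notF j : j \notin F -> u (inl (j, false)) = 0 /\ u (inl (j, true)) = 0.
  by rewrite finset.inE negb_or !negbK => /andP[/eqP -> /eqP ->].
have fv p : val_at G w u p = u (inr (vert G p)).
  by have /eqP := Hu (inl p); rewrite subr_eq0 => /eqP.
have fo x : \sum_(p | vert G p == x) out_at G w u p = (alpha x)%:C * u (inr x).
  by have /eqP := Hu (inr x); rewrite subr_eq0 => /eqP.
have v0 p : p.1 \notin F -> u (inr (vert G p)) = 0.
  by move=> /notF[a0 b0]; rewrite -fv /val_at a0 b0 /edge_sol !mul0r addr0.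
have o0 p : p.1 \notin F -> out_at G w u p = 0.
  by move=> /notF[a0 b0]; rewrite /out_at a0 b0 /edge_sol' !mul0r oppr0 addr0 mulr0.
have nF : no_degree_one G F.
  apply/forallP => x; apply/negP; rewrite /degree_in => /cards1P[p pE].
  have pP q : (q.1 \in F) && (vert G q == x) = (q == p).
    by have /finset.setP/(_ q) := pE; rewrite !finset.inE.
  have := pP p; rewrite eqxx => /andP[pF /eqP px].
  have ux : u (inr x) = 0.
    have [xb|xb] := boolP (boundary_vertex G x); first by apply/HB/B_boundary.
    have [/forallP H|/forallPn[q]] := boolP [forall q : D, (vert G q == x) ==> (q == p)].
      case/negP: xb; apply/cards1P; exists p; apply/finset.setP => q.
      rewrite !finset.inE /=; apply/idP/eqP => [qx|->]; last exact/eqP.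
      by have := H q; rewrite qx => /eqP.
    rewrite negb_imply => /andP[/eqP qx qp]; rewrite -qx; apply: v0.
    by move: (pP q); rewrite (negbTE qp) qx eqxx andbT => ->.
  have op : out_at G w u p = 0.
    have := fo x; rewrite ux mulr0 (bigD1 p) /=; last exact/eqP.
    rewrite big1 ?addr0// => q /andP[/eqP qx qp]; apply: o0.
    by move: (pP q); rewrite (negbTE qp) qx eqxx andbT => ->.
  have vp : val_at G w u p = 0 by rewrite fv px.
  have [a0 b0] := edge_zero_end vp op.
  by move: pF; rewrite finset.inE a0 b0 eqxx.
have ux x : u (inr x) = 0.
  have [xc|/forallPn[p]] := boolP (proper_core_vertex G x); first exact/HB/B_core.
  rewrite negb_imply => /andP[/eqP <- pc]; apply: v0.
  by apply: contra pc; exact: (fintype.subsetP (sub_core nF)).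
have a0 j : u (inl (j, false)) = 0.
  by have := fv (j, false); rewrite ux /val_at /endpoint /= edge_sol0.
have sF j : j \in F -> sinw w (len G j) = 0.
  rewrite finset.inE a0 eqxx /= => b0; apply/eqP.
  have := fv (j, true); rewrite ux /val_at /endpoint /= a0 /edge_sol mul0r add0r => /eqP.
  by rewrite mulf_eq0 (negbTE b0).
have F0 j : j \notin F.
  apply/negP => jF; have [c cc cF] := exists_cycle nF jF.
  have [k [l [/cF/sF k0 /cF/sF l0]]] := cycles cc.
  exact: (sinw_eq0_rational (len_gt0 G k) (len_gt0 G l) k0 l0).
by move=> [[j []]|x]; [have [] := notF j (F0 j)|have [] := notF j (F0 j)|exact: ux].
Qed.

Lemma sum_unknown (X : unknown -> C) :
  \sum_k X k = \sum_p X (inl p) + \sum_v X (inr v).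
Proof. by rewrite big_sumType. Qed.

(** The transposed system has the same solutions: an element y of the right kernel
    consists of the vertex values of an eigenfunction, at the indices inr v, and
    of the opposites of its outward derivatives, at the indices inl p.  This is the
    symmetry of the Lagrange bracket on the pairs of value and derivative. *)
Lemma right_kernel (lambda : R) (y : unknown -> C) :
  (forall u, \sum_k eqn G alpha lambda%:C u k * y k = 0) ->
  (forall v, v \in B -> y (inr v) = 0) -> forall i, y i = 0.
Proof.
move=> Hy HB; set w := lambda%:C in Hy.
(* Test the relation on the unknowns of one edge, then of one vertex. *)
have Hedge j a b : let f := edge_sol w a b in let f' := edge_sol' w a b in
    f (len G j) * y (inl (j, true)) + f' (len G j) * y (inr (vert G (j, true)))
    + (a * y (inl (j, false)) - b * y (inr (vert G (j, false)))) = 0.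
  move=> f f'.
  pose u (k : unknown) : C := if k is inl (j', e) then
    (if j' == j then (if e then b else a) else 0) else 0.
  have := Hy u; rewrite sum_unknown /=.
  have -> : \sum_p (val_at G w u p - 0) * y (inl p) = \sum_p val_at G w u p * y (inl p).
    by apply: eq_bigr => p _; rewrite subr0.
  have -> : \sum_v (\sum_(p | vert G p == v) out_at G w u p - (alpha v)%:C * 0) * y (inr v)
     = \sum_p out_at G w u p * y (inr (vert G p)).
    rewrite (sum_vertices G); apply: eq_bigr => v _; rewrite mulr0 subr0 mulr_suml.
    by apply: eq_bigr => p /eqP ->.
  rewrite -big_split /= sum_darts (bigD1 j) //= [X in _ + X]big1 ?addr0 => [|k kj].
    rewrite /val_at /out_at /u /= eqxx /endpoint /= !expr0 !expr1 edge_sol0 edge_sol'0.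
    by rewrite !mul1r !mulN1r mulNr -/f -/f'.
  have e0 x : edge_sol w 0 0 x = 0 by rewrite /edge_sol !mul0r addr0.
  have e0' x : edge_sol' w 0 0 x = 0 by rewrite /edge_sol' !mul0r oppr0 addr0.
  by rewrite /val_at /out_at /u /= (negbTE kj) !e0 !e0' !mulr0 !mul0r !addr0.
have Hvert x : \sum_(p | vert G p == x) y (inl p) + (alpha x)%:C * y (inr x) = 0.
  pose u (k : unknown) : C := if k is inr v then (v == x)%:R else 0.
  have := Hy u; rewrite sum_unknown /=.
  have -> : \sum_p (val_at G w u p - (vert G p == x)%:R) * y (inl p)
      = - \sum_(p | vert G p == x) y (inl p).
    rewrite [in RHS]big_mkcond -sumrN; apply: eq_bigr => p _.
    rewrite /val_at /u /edge_sol !mul0r addr0 sub0r.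
    by case: eqP => _; rewrite ?mulN1r// oppr0 mul0r.
  have -> : \sum_v (\sum_(p | vert G p == v) out_at G w u p - (alpha v)%:C * (v == x)%:R)
      * y (inr v) = - ((alpha x)%:C * y (inr x)).
    rewrite (bigD1 x) //= [X in _ + X]big1 => [|v vx].
      rewrite big1 => [|p _]; first by rewrite eqxx mulr1 sub0r mulNr addr0.
      by rewrite /out_at /u /edge_sol' !mul0r oppr0 addr0 mulr0.
    rewrite big1 => [|p _]; first by rewrite (negbTE vx) mulr0 subr0 mul0r.
    by rewrite /out_at /u /edge_sol' !mul0r oppr0 addr0 mulr0.
  by move/eqP; rewrite -opprD oppr_eq0 => /eqP.
pose u (k : unknown) : C := match k with
  | inl (j, false) => y (inr (vert G (j, false)))
  | inl (j, true) => y (inl (j, false))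
  | inr v => y (inr v) end.
have edge j : edge_sol w (y (inr (vert G (j, false)))) (y (inl (j, false))) (len G j)
      = y (inr (vert G (j, true))) /\
    edge_sol' w (y (inr (vert G (j, false)))) (y (inl (j, false))) (len G j)
      = - y (inl (j, true)).
  have := Hedge j 1 0; have := Hedge j 0 1; rewrite /edge_sol /edge_sol' /=.
  have := cosw2Dsinw2 w (len G j).
  set c := cosw _ _; set t := sinw _ _.
  set y1 := y (inl (j, true)); set y0 := y (inl (j, false)).
  set v1 := y (inr (vert G (j, true))); set v0 := y (inr (vert G (j, false))).
  move=> W H1 H2.
  have v0E : v0 = t * y1 + c * v1 by apply/eqP; rewrite -subr_eq0; apply/eqP; rewrite -[RHS]oppr0 -H1; ring.
  have y0E : y0 = - (c * y1) + w * t * v1.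
    by apply/eqP; rewrite -subr_eq0; apply/eqP; rewrite -H2; ring.
  rewrite v0E y0E; split.
    by rewrite -[RHS]mulr1 -W; ring.
  by rewrite -[y1 in RHS]mulr1 -W; ring.
have vu p : val_at G w u p = y (inr (vert G p)).
  case: p => j []; rewrite /val_at /endpoint /=; first by have [] := edge j.
  by rewrite edge_sol0.
have ou p : out_at G w u p = - y (inl p).
  case: p => j []; rewrite /out_at /endpoint /=.
    by rewrite expr0 mul1r; have [] := edge j.
  by rewrite expr1 mulN1r edge_sol'0.
have u0 : forall i, u i = 0.
  apply: (@unique_continuation lambda) => [[p|v]|v vB]; last exact: HB.
    by rewrite /= vu subrr.
  rewrite /= (eq_bigr (fun p => - y (inl p))) => [|p _]; last exact: ou.
  by rewrite sumrN -opprD Hvert oppr0.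
have yv v : y (inr v) = 0 by exact: (u0 (inr v)).
move=> [[j []]|v]; last exact: yv.
  have [_ /eqP] := edge j; rewrite yv (u0 (inl (j, true)) : y (inl (j, false)) = 0).
  by rewrite /edge_sol' !mul0r oppr0 addr0 eq_sym oppr_eq0 => /eqP.
exact: (u0 (inl (j, true))).
Qed.

End Kernels.

(** * The matrix of the vertex conditions *)

Section SecondOrder.
Context {R : realType}.
Local Notation C := R[i].
Implicit Types (F H : C -> C) (z d : C).

(** F(w) = F(z) + (w - z) F1(w) with F1(z) = d and F1 itself of the kind holo1:
    the first quotient builds the matrix T2 of the simple pole, and a second one
    subtracts its polar part. *)
Definition holo2 F z d : Prop := exists F1, [/\
  forall w, F w = F z + (w - z) * F1 w, holo1 F1 z & F1 z = d].

Lemma holo2_holo1 F z d : holo2 F z d -> holo1 F z.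
Proof.
move=> [F1 [FE hF1 _]]; exists F1; first exact: holo1_canalytic.
exact: nearW_C.
Qed.

Lemma holo2_eq F z d d' : holo2 F z d -> d = d' -> holo2 F z d'.
Proof. by move=> + <-. Qed.

Lemma holo2_cst c z : holo2 (fun=> c) z 0.
Proof.
exists (fun=> 0); split=> [w||//]; first by rewrite mulr0 addr0.
exact: holo1_cst.
Qed.

Lemma holo2_id z : holo2 id z 1.
Proof.
exists (fun=> 1); split=> [w||//]; first by rewrite mulr1 addrC subrK.
exact: holo1_cst.
Qed.

Lemma holo2D F H z d d' : holo2 F z d -> holo2 H z d' ->
  holo2 (fun w => F w + H w) z (d + d').
Proof.
move=> [F1 [FE hF <-]] [H1 [HE hH <-]]; exists (fun w => F1 w + H1 w).
split=> [w||//]; first by rewrite FE HE; ring.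
exact: holo1D.
Qed.

Lemma holo2M F H z d d' : holo2 F z d -> holo2 H z d' ->
  holo2 (fun w => F w * H w) z (d * H z + F z * d').
Proof.
move=> hF2 hH2; have hF0 := holo2_holo1 hF2; have hH0 := holo2_holo1 hH2.
move: hF2 hH2 => [F1 [FE hF <-]] [H1 [HE hH <-]].
exists (fun w => F1 w * H w + F z * H1 w).
split=> [w||//]; first by rewrite FE HE; ring.
by apply: holo1D; apply: holo1M => //; exact: holo1_cst.
Qed.

Lemma holo2Z c F z d : holo2 F z d -> holo2 (fun w => c * F w) z (c * d).
Proof.
by move=> hF; apply: holo2_eq (holo2M (holo2_cst c z) hF) _; rewrite mul0r add0r.
Qed.

Lemma holo2_sum (I : Type) (r : seq I) (P : pred I) (F : I -> C -> C) z (d : I -> C) :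
  (forall i, P i -> holo2 (F i) z (d i)) ->
  holo2 (fun w => \sum_(i <- r | P i) F i w) z (\sum_(i <- r | P i) d i).
Proof.
move=> H; elim: r => [|i r IH].
  by rewrite big_nil; under eq_fun do rewrite big_nil; exact: holo2_cst.
rewrite big_cons; have [Pi|Pi] := boolP (P i).
  by under eq_fun do rewrite big_cons Pi; apply: holo2D => //; exact: H.
by under eq_fun do rewrite big_cons (negbTE Pi).
Qed.

Lemma holo2_cosw x z : holo2 (fun w => cosw w x) z (dcosw z x).
Proof.
have [a [ra aE dE]] := cosw_entire x; exists (eser (divdiff a z)).
split=> [w||]; [by rewrite !aE; exact: divdiffE| |exact: dE].
exact: holo1_eser (rapid_divdiff z ra).
Qed.

Lemma holo2_sinw x z : holo2 (fun w => sinw w x) z (dsinw z x).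
Proof.
have [a [ra aE dE]] := sinw_entire x; exists (eser (divdiff a z)).
split=> [w||]; [by rewrite !aE; exact: divdiffE| |exact: dE].
exact: holo1_eser (rapid_divdiff z ra).
Qed.

Lemma holo2_edge_sol a b x z :
  holo2 (fun w => edge_sol w a b x) z (dedge_sol z a b x).
Proof. by apply: holo2D; apply: holo2Z; [exact: holo2_cosw|exact: holo2_sinw]. Qed.

Lemma holo2_edge_sol' a b x z :
  holo2 (fun w => edge_sol' w a b x) z (dedge_sol' z a b x).
Proof.
have h1 := holo2M (holo2_id z) (holo2_sinw x z); rewrite mul1r in h1.
have h2 := holo2D (holo2Z (- a) h1) (holo2Z b (holo2_cosw x z)).
have -> : (fun w => edge_sol' w a b x) = (fun w => - a * (w * sinw w x) + b * cosw w x).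
  by apply/funext => w; rewrite /edge_sol' mulNr.
by apply: holo2_eq h2 _; rewrite /dedge_sol' mulNr.
Qed.

End SecondOrder.

Section VertexMatrix.
Context {R : realType} {r s : nat} (G : metric_graph R r s) (alpha : 'I_s -> R).
Local Notation C := R[i].
Local Notation D := ('I_r * bool)%type.
Local Notation unknown := ('I_r * bool + 'I_s)%type.
Local Notation n := #|{: unknown}|.
Implicit Types (w z : C) (u : 'rV[C]_n).

Definition unit_unknown (i : 'I_n) : unknown -> C := fun x => (x == enum_val i)%:R.

Definition vertex_mx w : 'M[C]_n :=
  \matrix_(i, k) eqn G alpha w (unit_unknown i) (enum_val k).

Definition deriv_vertex_mx w : 'M[C]_n :=
  \matrix_(i, k) deqn G w (unit_unknown i) (enum_val k).

Lemma vertex_mxE w i k :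
  vertex_mx w i k = eqn G alpha w (unit_unknown i) (enum_val k).
Proof. by rewrite mxE. Qed.

Lemma deriv_vertex_mxE w i k :
  deriv_vertex_mx w i k = deqn G w (unit_unknown i) (enum_val k).
Proof. by rewrite mxE. Qed.

Definition unknown_of u : unknown -> C := fun x => u 0 (enum_rank x).

Definition row_of (x : unknown -> C) : 'rV[C]_n := \row_i x (enum_val i).

Lemma row_ofK (x : unknown -> C) : unknown_of (row_of x) = x.
Proof. by apply/funext => i; rewrite /unknown_of mxE enum_rankK. Qed.

Lemma unknown_ofK u : row_of (unknown_of u) = u.
Proof. by apply/rowP => i; rewrite mxE /unknown_of enum_valK. Qed.

Lemma linear_unknown (L : (unknown -> C) -> C) u :
  (forall c x y, L (fun i => c * x i + y i) = c * L x + L y) ->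
  L (unknown_of u) = \sum_i u 0 i * L (unit_unknown i).
Proof.
move=> Llin; have L0 : L (fun=> 0) = 0.
  have E := Llin (-1) (fun=> 0) (fun=> 0).
  have -> : (fun=> 0) = (fun i : unknown => -1 * 0 + 0) :> (unknown -> C).
    by apply/funext => i; rewrite mulr0 addr0.
  by rewrite {}E [-1 * L _]mulN1r addNr.
have Lsum (t : seq 'I_n) : L (fun x => \sum_(i <- t) u 0 i * unit_unknown i x)
    = \sum_(i <- t) u 0 i * L (unit_unknown i).
  elim: t => [|i t IH].
    by rewrite big_nil -[RHS]L0; congr L; apply/funext => x; rewrite big_nil.
  rewrite big_cons -IH -Llin; congr L; apply/funext => x; by rewrite big_cons.
rewrite -Lsum; congr L; apply/funext => x.
rewrite (bigD1 (enum_rank x)) //= big1 => [|i ix].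
  by rewrite /unit_unknown enum_rankK eqxx mulr1 addr0.
rewrite /unit_unknown; case: eqP => [xi|_]; last by rewrite mulr0.
by rewrite xi enum_valK eqxx in ix.
Qed.

Lemma mul_vertex_mx w u : u *m vertex_mx w = row_of (eqn G alpha w (unknown_of u)).
Proof.
apply/rowP => k; rewrite !mxE.
rewrite (linear_unknown _ (fun c x y => eqn_linear G alpha w c x y (enum_val k))).
by apply: eq_bigr => i _; rewrite mxE.
Qed.

Lemma mul_deriv_vertex_mx w u : u *m deriv_vertex_mx w = row_of (deqn G w (unknown_of u)).
Proof.
apply/rowP => k; rewrite !mxE.
rewrite (linear_unknown _ (fun c x y => deqn_linear G w c x y (enum_val k))).
by apply: eq_bigr => i _; rewrite mxE.
Qed.

Lemma holo2_eqn (x : unknown -> C) k z :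
  holo2 (fun w => eqn G alpha w x k) z (deqn G z x k).
Proof.
case: k => [p|v] /=.
  apply: holo2_eq (holo2D (holo2_edge_sol _ _ _ z) (holo2_cst _ z)) _.
  by rewrite addr0.
apply: holo2_eq (holo2D (holo2_sum _ _) (holo2_cst _ z)) _; last first.
  by rewrite addr0.
by move=> p _; apply: holo2Z; exact: holo2_edge_sol'.
Qed.

Lemma holo2_vertex_mx i k z : holo2 (fun w => vertex_mx w i k) z (deriv_vertex_mx z i k).
Proof.
under eq_fun do rewrite vertex_mxE.
by rewrite deriv_vertex_mxE; exact: holo2_eqn.
Qed.

Lemma vertex_mx_quotient z : exists T1 : C -> 'M[C]_n, [/\
  forall w, vertex_mx w = vertex_mx z + (w - z) *: T1 w,
  holo1_mx T1 z & T1 z = deriv_vertex_mx z].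
Proof.
have /choice[f Hf] : forall p : 'I_n * 'I_n, exists F1, [/\
    forall w, vertex_mx w p.1 p.2 = vertex_mx z p.1 p.2 + (w - z) * F1 w,
    holo1 F1 z & F1 z = deriv_vertex_mx z p.1 p.2].
  move=> p; exact: holo2_vertex_mx.
exists (fun w => \matrix_(i, k) f (i, k) w); split=> [w|i k|].
- apply/matrixP => i k; have [H _ _] := Hf (i, k).
  rewrite [RHS]mxE [X in _ + X]mxE [X in _ * X]mxE; exact: H.
- by under eq_fun do rewrite mxE; have [_ + _] := Hf (i, k); exact.
- by apply/matrixP => i k; have [_ _ H] := Hf (i, k); rewrite mxE; exact: H.
Qed.

Lemma holo1_vertex_mx z : holo1_mx vertex_mx z.
Proof.
by move=> i k; exact: holo2_holo1 (holo2_vertex_mx i k z).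
Qed.

Lemma row_of_eq0 (x : unknown -> C) : row_of x = 0 -> forall i, x i = 0.
Proof. by move=> x0 i; rewrite -(row_ofK x) x0 /unknown_of mxE. Qed.

Lemma vertex_mx_inverse (lambda : R) : let z := lambda%:C in
  exists (A : 'M[C]_n) (h : C -> 'M[C]_n), [/\
    forall i j, canalytic (fun w => h w i j) z,
    A *m vertex_mx z = 0, vertex_mx z *m A = 0,
    \rank A = \rank (kermx (vertex_mx z)) &
    \forall w \near z^', vertex_mx w \in unitmx /\
      invmx (vertex_mx w) = (w - z)^-1 *: A + h w].
Proof.
move=> z; have [T1 [TE hT1 T1z]] := vertex_mx_quotient z.
apply: (simple_pole_inverse (holo1_vertex_mx z) hT1 TE) => u v.
rewrite T1z !mul_vertex_mx mul_deriv_vertex_mx => /row_of_eq0 u0 uv0.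
rewrite -[u]unknown_ofK; apply/rowP => i; rewrite !mxE.
apply: (no_jordan_chain u0) => k.
by have /rowP/(_ (enum_rank k)) := uv0; rewrite !mxE enum_rankK; exact.
Qed.

End VertexMatrix.

Section Solutions.
Context {R : realType} {r s : nat} (G : metric_graph R r s) (alpha : 'I_s -> R).
Local Notation C := R[i].
Local Notation D := ('I_r * bool)%type.
Local Notation unknown := ('I_r * bool + 'I_s)%type.
Implicit Types (f : gfun (R := R) (r := r)) (w : C) (u : unknown -> C).

Definition graph_sol w u : 'I_r -> R -> C :=
  fun j => edge_sol w (u (inl (j, false))) (u (inl (j, true))).

Lemma vertex_valueE f p :
  (forall p q, vert G p = vert G q -> end_value G f p = end_value G f q) ->
  vertex_value G f (vert G p) = end_value G f p.
Proof.
move=> fE; rewrite /vertex_value; case: pickP => [q /eqP/fE //|/(_ p)].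
by rewrite eqxx.
Qed.

Lemma dnu_out f w u v :
  (forall j, deriv_left f j = edge_sol' w (u (inl (j, false))) (u (inl (j, true))) 0) ->
  (forall j, deriv_right G f j
     = edge_sol' w (u (inl (j, false))) (u (inl (j, true))) (len G j)) ->
  dnu G f v = \sum_(p | vert G p == v) out_at G w u p.
Proof.
move=> fl fr; rewrite big_mkcond sum_darts big_split /= /dnu; congr (_ + _).
  rewrite big_mkcond; apply: eq_bigr => j _; rewrite fr.
  by rewrite /out_at /endpoint /= expr0 mul1r.
rewrite -sumrN big_mkcond; apply: eq_bigr => j _; rewrite fl.
by rewrite /out_at /endpoint /= expr1 mulN1r.
Qed.

(** Every solution, understood almost everywhere and with absolutely continuous
    derivative, is given by its unknowns, and its vertex defects are the right hand
    sides of the vertex equations. *)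
Lemma solution_unknown f w : AC2 G f -> gcontinuous G f ->
  Laplacian G f (fun j x => w * f j x) ->
  exists u, [/\ forall p, eqn G alpha w u (inl p) = 0,
    forall v, eqn G alpha w u (inr v) = delta_defect G alpha f v,
    forall v, u (inr v) = vertex_value G f v &
    forall j x, 0 <= x -> x <= len G j -> f j x = graph_sol w u j x].
Proof.
move=> acf [cf fE] Lf.
have /choice[ab Hab] : forall j, exists ab : C * C,
   [/\ forall x, 0 <= x -> x <= len G j -> f j x = edge_sol w ab.1 ab.2 x,
     deriv_left f j = edge_sol' w ab.1 ab.2 0 &
     deriv_right G f j = edge_sol' w ab.1 ab.2 (len G j)].
  move=> j; have [ac1 df ac2] := acf j.
  have [a [b H]] := edge_equation (len_gt0 G j) ac1 df ac2 (Lf j) (cf j).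
  by exists (a, b).
pose u (k : unknown) : C := match k with
  | inl (j, false) => (ab j).1 | inl (j, true) => (ab j).2
  | inr v => vertex_value G f v end.
have uE j x : 0 <= x -> x <= len G j -> f j x = graph_sol w u j x.
  by have [H _ _] := Hab j; exact: H.
exists u; split=> // [p|v].
  rewrite /= vertex_valueE// /end_value uE; first exact: subrr.
    by case: p.2 => //; exact/ltW/len_gt0.
  by case: p.2 => //; exact/ltW/len_gt0.
rewrite /= /delta_defect -(@dnu_out f w u)// => j.
  by have [_ + _] := Hab j.
by have [_ _ +] := Hab j.
Qed.

Lemma graph_sol_solution w u : (forall p, eqn G alpha w u (inl p) = 0) ->
  [/\ gL2 G (graph_sol w u), AC2 G (graph_sol w u), gcontinuous G (graph_sol w u),
    Laplacian G (graph_sol w u) (fun j x => w * graph_sol w u j x) &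
    (forall v, delta_defect G alpha (graph_sol w u) v = eqn G alpha w u (inr v)) /\
    (forall v, vertex_value G (graph_sol w u) v = u (inr v))].
Proof.
move=> u0.
have endE p : end_value G (graph_sol w u) p = u (inr (vert G p)).
  by have /eqP := u0 p; rewrite subr_eq0 => /eqP.
have cE p q : vert G p = vert G q ->
    end_value G (graph_sol w u) p = end_value G (graph_sol w u) q.
  by move=> E; rewrite (endE p) (endE q) E.
have vE v : vertex_value G (graph_sol w u) v = u (inr v).
  have [p <-] := vert_surj G v; rewrite (@vertex_valueE (graph_sol w u) p cE).
  exact: endE.
split.
- by move=> j; exact: edge_sol_square_integrable.
- move=> j; have L0 := ltW (len_gt0 G j); split.
  + exact: edge_sol_abs_continuous.
  + by move=> x _; eexists; exact: edge_sol_cderive.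
  + by rewrite cderive_edge_sol; exact: edge_sol'_abs_continuous.
- split; last exact: cE.
  by move=> j; apply: continuous_subspaceT; exact: edge_sol_continuous.
- move=> j; apply: ae_of_all => x _; rewrite cderive_edge_sol; exact: edge_sol'_cderive.
- split=> // v; rewrite /delta_defect vE (@dnu_out _ w u)// => j.
    exact: (edge_sol_lim w _ _ (len G j)).1.
  exact: (edge_sol_lim w _ _ (len G j)).2.
Qed.

End Solutions.

(** * Laurent expansions at a simple pole *)

Section Laurent.
Context {R : realType}.
Local Notation C := R[i].
Implicit Types (F H : C -> C) (z w : C).

Lemma continuous_near_eq0 F z : {for z, continuous F} ->
  (\forall w \near z^', F w = 0) -> F z = 0.
Proof.
move=> /continuous_cP cF /near_dnbhs_cP[e e0 He]; apply/eqP.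
rewrite -normc_le0 leNgt; apply/negP => Fz; have [d d0 Hd] := cF _ Fz.
pose h := (Num.min e d / 2); have h0 : 0 < h by rewrite divr_gt0 ?lt_min ?e0.
have hE : normc (z + h%:C - z) = h by rewrite addrC addKr normcR ger0_norm// ltW.
have [he hd] : h < e /\ h < d.
  have : 2 * h <= Num.min e d by rewrite /h mulrC divfK.
  by rewrite le_min => /andP[? ?]; split; lra.
have F0 : F (z + h%:C) = 0.
  apply: He; first by rewrite hE.
  by rewrite -subr_eq0 addrC addKr -normc_gt0 normcR normr_gt0 lt0r_neq0.
by have := Hd (z + h%:C); rewrite hE => /(_ hd); rewrite F0 sub0r normcN ltxx.
Qed.

(** Multiplying by (w - z)^m and letting w tend to z kills the coefficient of
    highest order. *)
Lemma laurent_unique m (c : nat -> C) H z : {for z, continuous H} ->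
  (\forall w \near z^', \sum_(k < m) (w - z) ^- k.+1 * c k = H w) ->
  forall k, (k < m)%N -> c k = 0.
Proof.
move=> cH; elim: m => [//|m IH] E.
pose P w := \sum_(k < m.+1) (w - z) ^+ (m - k) * c k - (w - z) ^+ m.+1 * H w.
have cm : c m = 0.
  have hX j : holo1 (fun w => (w - z) ^+ j) z.
    elim: j => [|j IHj]; first by under eq_fun do rewrite expr0; exact: holo1_cst.
    under eq_fun do rewrite exprS; apply: holo1M => //.
    by apply: holo1D; [exact: holo1_id|exact: holo1_cst].
  have hS : holo1 (fun w => \sum_(k < m.+1) (w - z) ^+ (m - k) * c k) z.
    by apply: holo1_sum => k _; apply: holo1M; [exact: hX|exact: holo1_cst].
  have cP : {for z, continuous P}.
    have c1 := canalytic_continuous (holo1_canalytic hS).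
    have c2 := canalytic_continuous (holo1_canalytic (hX m.+1)).
    exact: (cvgB c1 (cvgM c2 cH)).
  have P0 : P z = 0.
    apply: (continuous_near_eq0 cP); have ne : \forall w \near z^', w != z.
      exact: nbhs_dnbhs_neq.
    apply: filterS2 ne E => w wz Ew; rewrite /P -Ew; apply/eqP; rewrite subr_eq0 mulr_sumr.
    apply/eqP; apply: eq_bigr => k _.
    have wz0 : w - z != 0 by rewrite subr_eq0.
    rewrite mulrA; congr (_ * _); apply: (mulIf (expf_neq0 k.+1 wz0)).
    rewrite -mulrA mulVf ?expf_neq0// mulr1 -exprD; congr (_ ^+ _).
    by have := ltn_ord k; lia.
  move: P0; rewrite /P subrr expr0n mul0r subr0 big_ord_recr /= subnn expr0 mul1r.
  rewrite big1 ?add0r// => k _; rewrite expr0n.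
  have -> : (m - k == 0)%N = false by have := ltn_ord k; lia.
  by rewrite mul0r.
move=> k; rewrite ltnS leq_eqVlt => /predU1P[->//|]; apply: IH.
by apply: filterS E => w <-; rewrite big_ord_recr /= cm mulr0 addr0.
Qed.

End Laurent.

Section SimplePole.
Context {R : realType} {m : nat}.
Local Notation C := R[i].
Variables (M h : C -> 'M[C]_m) (z : C) (A : 'M[C]_m).
Hypothesis h_analytic : forall i j, canalytic (fun w => h w i j) z.
Hypothesis ME : \forall w \near z^', M w = (w - z)^-1 *: A + h w.

Lemma analytic_at_entries (H : C -> 'M[C]_m) :
  (forall i j, canalytic (fun w => H w i j) z) <-> analytic_at H z.
Proof.
split=> [aH|aH i j]; last by apply: filterS aH => w; exact.
have : \forall w \near z, forall p : 'I_m * 'I_m, derivable (fun w => H w p.1 p.2) w 1.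
  by apply: (@filter_forall _ _ _ _ (nbhs_filter z)) => p; exact: aH.
by apply: filterS => w H1 i j; exact: (H1 (i, j)).
Qed.

Lemma simple_pole_residue A' : is_residue M z A' -> A' = A.
Proof.
move=> [n [c [H [aH <- E]]]]; apply/matrixP => i j.
pose c' k := c k i j - (k == 0%N)%:R * A i j.
suff : c' 0%N = 0 by rewrite /c' eqxx mul1r => /eqP; rewrite subr_eq0 => /eqP.
have cH i' j' := canalytic_continuous ((analytic_at_entries H).2 aH i' j').
have ch i' j' := canalytic_continuous (h_analytic i' j').
apply: (@laurent_unique R n.+1 c' (fun w => h w i j - H w i j) z) => //.
  exact: (cvgB (ch i j) (cH i j)).
apply: filterS2 ME E => w -> /matrixP/(_ i j); rewrite !mxE summxE.
have -> : \sum_(k < n.+1) ((w - z) ^- k.+1 *: c k) i j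
   = \sum_(k < n.+1) (w - z) ^- k.+1 * c k i j.
  by apply: eq_bigr => k _; rewrite mxE.
have E1 : \sum_(k < n.+1) (w - z) ^- k.+1 * ((k == 0%N :> nat)%:R * A i j)
   = (w - z)^-1 * A i j.
  rewrite big_ord_recl /= expr1 mul1r big1 ?addr0// => k _.
  by rewrite mul0r mulr0.
move=> E; rewrite /c'; under eq_bigr do rewrite mulrBr.
rewrite sumrB E1; apply/eqP; rewrite subr_eq addrAC eq_sym subr_eq eq_sym addrC.
by rewrite E addrC.
Qed.

Lemma simple_pole_is_residue : is_residue M z A.
Proof.
exists 0%N, (fun=> A), h; split=> //; first exact/analytic_at_entries.
by apply: filterS ME => w ->; rewrite big_ord1 expr1.
Qed.

Lemma simple_pole_residueE : residue M z = A.
Proof.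
apply: simple_pole_residue; rewrite /residue.
exact: (xgetI _ simple_pole_is_residue).
Qed.

(** Every point of the punctured neighborhood has a neighborhood avoiding z, on
    which M is the sum of two differentiable functions. *)
Lemma simple_pole_isolated : isolated_singularity M z.
Proof.
have [e e0 He] := (near_dnbhs_cP z _).1 ME.
have [d d0 Hd] := (nearcP z _).1 ((analytic_at_entries h).1 h_analytic).
apply/near_dnbhs_cP; exists (Num.min e d); first by rewrite lt_min e0.
move=> w; rewrite lt_min => /andP[we wd] wz i j.
have wz0 : w - z != 0 by rewrite subr_eq0.
apply: (@near_eq_derivable _ _ _ (fun w => (w - z)^-1 * A i j + h w i j)).
  apply/nearcP; exists (Num.min (e - normc (w - z)) (normc (w - z))).
    by rewrite lt_min subr_gt0 we normc_gt0.
  move=> t; rewrite lt_min => /andP[te tz]; rewrite He ?mxE//.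
    have := le_normcD (t - w) (w - z); rewrite addrA subrK; lra.
  by apply: contraTneq tz => ->; rewrite distcC ltxx.
apply: derivableD; last exact: Hd.
apply: derivableM; last exact: derivable_cst.
exact: derivableV.
Qed.

Lemma simple_pole_removable : removable M z <-> A = 0.
Proof.
split=> [[H aH E]|A0].
  apply/esym/simple_pole_residue; exists 0%N, (fun=> 0), H; split=> //.
  by apply: filterS E => w ->; rewrite big_ord1 scaler0 add0r.
exists h; first exact/analytic_at_entries.
by apply: filterS ME => w ->; rewrite A0 scaler0 add0r.
Qed.

Lemma simple_pole_is_pole : is_pole M z <-> A <> 0.
Proof.
split=> [[_ nr] A0|A0]; first exact/nr/simple_pole_removable.
by split; [exact: simple_pole_isolated|move/simple_pole_removable].
Qed.

End SimplePole.

Lemma mxrank_mul_inj (F : fieldType) m n p (A : 'M[F]_(m, n)) (X : 'M[F]_(n, p)) :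
  (forall v : 'rV_n, (v <= A)%MS -> v *m X = 0 -> v = 0) -> \rank (A *m X) = \rank A.
Proof.
move=> H; rewrite -[RHS](mxrank_mul_ker A X).
suff -> : (A :&: kermx X)%MS = 0 by rewrite mxrank0 addn0.
apply/eqP/rowV0P => v; rewrite sub_capmx => /andP[vA /sub_kermxP]; exact: H.
Qed.

(** * The Titchmarsh-Weyl matrix near a real point *)

Section TitchmarshWeyl.
Context {R : realType} {r s : nat} (G : metric_graph R r s) (alpha : 'I_s -> R).
Variable B : {set 'I_s}.
Local Notation C := R[i].
Local Notation unknown := ('I_r * bool + 'I_s)%type.
Local Notation n := #|{: unknown}|.
Implicit Types (w z : C) (u : 'rV[C]_n).

Definition vertex_index (k : 'I_#|B|) : 'I_n := enum_rank (inr (enum_val k) : unknown).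

(** The l-th solution has unknowns delta_l T(w)^-1, where T(w) is the matrix of the
    vertex conditions, so the Weyl matrix is the transpose of a block of T(w)^-1. *)
Lemma TW_inverse w : vertex_mx G alpha w \in unitmx ->
  TW G alpha B w = (mxsub vertex_index vertex_index (invmx (vertex_mx G alpha w)))^T.
Proof.
move=> Tw; apply/matrixP => k l; rewrite !mxE.
pose e : 'rV[C]_n := delta_mx 0 (vertex_index l).
have eE (x : unknown -> C) : (forall p, eqn G alpha w x (inl p) = 0) ->
    (forall v, eqn G alpha w x (inr v) = (v == enum_val l)%:R) ->
    row_of x *m vertex_mx G alpha w = e.
  move=> x0 x1; rewrite mul_vertex_mx row_ofK; apply/rowP => i.
  rewrite [LHS]mxE [RHS]mxE eqxx /=.
  have -> : (i == vertex_index l) = (enum_val i == inr (enum_val l)).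
    by rewrite -(inj_eq enum_rank_inj) enum_valK.
  by case: (enum_val i) => [p|v]; [rewrite x0|rewrite x1].
pose U := e *m invmx (vertex_mx G alpha w).
have UT : row_of (eqn G alpha w (unknown_of U)) = e by rewrite -mul_vertex_mx mulmxKV.
have Ueqn i : eqn G alpha w (unknown_of U) i = e 0 (enum_rank i).
  by rewrite -UT mxE enum_rankK.
have U0 p : eqn G alpha w (unknown_of U) (inl p) = 0.
  by rewrite Ueqn mxE eqxx /= (inj_eq enum_rank_inj).
have U1 v : eqn G alpha w (unknown_of U) (inr v) = (v == enum_val l)%:R.
  by rewrite Ueqn mxE eqxx /= (inj_eq enum_rank_inj).
have solU : TW_solution G alpha w l (graph_sol w (unknown_of U)).
  have [g1 g2 g3 g4 [g5 _]] := graph_sol_solution U0.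
  by split=> // v; rewrite g5 U1.
have [[_ fac] fc fL fd] := xgetI (fun _ _ => 0) solU.
have [x [x0 x1 x2 _]] := solution_unknown alpha fac fc fL.
rewrite -x2.
have xU : row_of x = U.
  by rewrite /U -(eE x x0) ?mulmxK// => v; rewrite x1 fd.
rewrite -[x]row_ofK xU /unknown_of /U -/(vertex_index k).
by rewrite -rowE mxE.
Qed.

Lemma TW_simple_pole (lambda : R) (A : 'M[C]_n) (h : C -> 'M[C]_n) :
  (\forall w \near (lambda%:C : C)^', vertex_mx G alpha w \in unitmx /\
     invmx (vertex_mx G alpha w) = (w - lambda%:C)^-1 *: A + h w) ->
  \forall w \near (lambda%:C : C)^', TW G alpha B w
    = (w - lambda%:C)^-1 *: (mxsub vertex_index vertex_index A)^T
      + (mxsub vertex_index vertex_index (h w))^T.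
Proof.
apply: filterS => w [Tw TE]; rewrite (TW_inverse Tw) TE.
by apply/matrixP => k l; rewrite !mxE.
Qed.

Definition graph_sol_row w u := graph_sol w (unknown_of u).

Lemma graph_sol_row_sum w (I : Type) (t : seq I) (c : I -> C) (u : I -> 'rV[C]_n) j x :
  graph_sol_row w (\sum_(i <- t) c i *: u i) j x
  = \sum_(i <- t) c i * graph_sol_row w (u i) j x.
Proof.
elim: t => [|i t IH].
  by rewrite !big_nil /graph_sol_row /graph_sol /edge_sol /unknown_of !mxE !mul0r addr0.
rewrite !big_cons -IH /graph_sol_row /graph_sol /edge_sol /unknown_of !mxE; ring.
Qed.

Lemma kernel_row w u : u *m vertex_mx G alpha w = 0 ->
  forall k, eqn G alpha w (unknown_of u) k = 0.
Proof. by rewrite mul_vertex_mx; exact: row_of_eq0. Qed.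

Lemma graph_sol_row_ker w u : u *m vertex_mx G alpha w = 0 ->
  ker_A G alpha w (graph_sol_row w u).
Proof.
move=> /kernel_row u0.
have [g1 g2 g3 g4 [g5 _]] := graph_sol_solution (fun p => u0 (inl p)).
split=> //; split=> //; last by move=> v; rewrite g5.
exists (fun j x => w * graph_sol_row w u j x) => // j.
have -> : (fun x => w * graph_sol_row w u j x)
  = edge_sol w (w * unknown_of u (inl (j, false))) (w * unknown_of u (inl (j, true))).
  by apply/funext => x; rewrite /graph_sol_row /graph_sol /edge_sol; ring.
exact: edge_sol_square_integrable.
Qed.

Lemma graph_sol_row_ae0 w u : u *m vertex_mx G alpha w = 0 ->
  gae_eq G (graph_sol_row w u) (fun _ _ => 0) -> u = 0.
Proof.
move=> /kernel_row u0 ae0.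
have ab j := edge_sol_ae0 (len_gt0 G j) (ae0 j).
rewrite -[u]unknown_ofK; apply/rowP => i; rewrite !mxE.
case: (enum_val i) => [[j []]|v]; [by have [] := ab j|by have [] := ab j|].
have [p <-] := vert_surj G v; have /eqP := u0 (inl p); rewrite subr_eq0 => /eqP <-.
by rewrite /val_at /edge_sol; have [-> ->] := ab p.1; rewrite !mul0r addr0.
Qed.

Lemma ker_graph_sol_row w f : ker_A G alpha w f ->
  exists2 u, u *m vertex_mx G alpha w = 0 & gae_eq G f (graph_sol_row w u).
Proof.
move=> [[[_ fac] _ fc fd] fL].
have [x [x0 x1 _ x3]] := solution_unknown alpha fac fc fL.
exists (row_of x).
  rewrite mul_vertex_mx row_ofK; apply/rowP => i; rewrite !mxE.
  by case: (enum_val i) => [p|v]; [rewrite x0|rewrite x1 fd].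
move=> j; apply: ae_of_all => t; rewrite in_itv /= => /andP[t0 tL].
by rewrite /graph_sol_row row_ofK x3.
Qed.

(** Unknowns in the left kernel of the matrix are the eigenfunctions, up to
    equality almost everywhere. *)
Lemma ker_has_dim w :
  has_dim G (ker_A G alpha w) (\rank (kermx (vertex_mx G alpha w))).
Proof.
pose K := kermx (vertex_mx G alpha w); pose b := row_base K.
have bK i : row i b *m vertex_mx G alpha w = 0.
  by apply/sub_kermxP; apply: submx_trans (row_sub i b) _; rewrite eq_row_base.
exists (fun i => graph_sol_row w (row i b)); split.
- by move=> i; exact: graph_sol_row_ker.
- move=> c ae0.
  have sumE : \sum_i c i *: row i b = (\row_i c i) *m b.
    by rewrite mulmx_sum_row; apply: eq_bigr => i _; rewrite mxE.
  have cb0 : (\row_i c i) *m b = 0.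
    apply: (@graph_sol_row_ae0 w).
      by rewrite -sumE mulmx_suml big1// => i _; rewrite -scalemxAl bK scaler0.
    move=> j; apply: ae_imply (ae0 j) => t H tL; rewrite -sumE graph_sol_row_sum.
    exact: H.
  have /rowP c0 : \row_i c i = 0.
    apply/eqP; rewrite -(mulmx_free_eq0 _ (row_base_free K)); exact/eqP.
  by move=> i; have := c0 i; rewrite !mxE.
- move=> f /ker_graph_sol_row[u uT fu].
  have : (u <= b)%MS by rewrite eq_row_base; exact/sub_kermxP.
  move=> /submxP[c uc]; exists (fun i => c 0 i) => j.
  apply: ae_imply (fu j) => t H tL; rewrite H// uc mulmx_sum_row.
  exact: graph_sol_row_sum.
Qed.

Lemma eigenvalue_has_dim (mu : C) d : has_dim G (ker_A G alpha mu) d ->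
  (eigenvalue_A G alpha mu <-> d != 0%N).
Proof.
move=> [b [bK free span]]; split=> [[f fK f0]|d0].
  apply/eqP => d0; apply: f0 => j; have [c Hc] := span f fK.
  apply: ae_imply (Hc j) => t H tL; rewrite H// big1// => i _.
  by have := ltn_ord i; rewrite {2}d0.
case: d d0 b bK free span => // d _ b bK free _; exists (b ord0); first exact: bK.
move=> b0; have := free (fun i => (i == ord0)%:R).
have H : gae_eq G (fun j x => \sum_i (i == ord0)%:R * b i j x) (fun _ _ => 0).
  move=> j; apply: ae_imply (b0 j) => t H tL; rewrite (bigD1 ord0) //= big1 => [|i i0].
    by rewrite mul1r addr0 H.
  by rewrite (negbTE i0) mul0r.
by move=> /(_ H ord0) /eqP; rewrite eqxx oner_eq0.
Qed.

End TitchmarshWeyl.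

Theorem corollary4p7 (R : realType) (r s : nat) (r_gt0 : (0 < r)%N)
  (G : metric_graph R r s) (B : {set 'I_s})
  (B_boundary : forall v, boundary_vertex G v -> v \in B)
  (B_core : forall v, proper_core_vertex G v -> v \in B)
  (alpha : 'I_s -> R)
  (cycles : forall c, is_cycle G c ->
     exists j k, [/\ j \in [seq d.1 | d <- c], k \in [seq d.1 | d <- c] &
       rationally_independent (len G j) (len G k)])
  (lambda : R) :
  (eigenvalue_A G alpha lambda%:C <-> is_pole (TW G alpha B) lambda%:C) /\
  has_dim G (ker_A G alpha lambda%:C) (\rank (residue (TW G alpha B) lambda%:C)).
Proof.
have [A [h [ah AT TA rA TE]]] := vertex_mx_inverse G alpha lambda.
set z := lambda%:C in ah AT TA TE *.
have HE := TW_simple_pole B TE.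
set g := @vertex_index r s B in HE.
have ah' i j : canalytic (fun w => (mxsub g g (h w))^T i j) z.
  by under eq_fun do rewrite !mxE; exact: ah.
rewrite (simple_pole_residueE ah' HE).
have inB v (vB : v \in B) : exists k : 'I_#|B|, g k = enum_rank (inr v).
  by exists (enum_rank_in vB v); rewrite /g /vertex_index enum_rankK_in.
(* The rows of the residue A of the inverse matrix lie in the left kernel and its
   columns in the right kernel; on both, restriction to the indices of B is
   injective, so that the block of A has the rank of A. *)
have rAB : \rank (mxsub g g A)^T = \rank (kermx (vertex_mx G alpha z)).
  rewrite mxrank_tr -rA.
  pose X := \matrix_(i, k) (i == g k)%:R : 'M[R[i]]_(_, #|B|).
  have mulX m (Y : 'M[R[i]]_(m, _)) : Y *m X = colsub g Y.
    apply/matrixP => i k; rewrite !mxE (bigD1 (g k)) //= mxE eqxx mulr1.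
    by rewrite big1 ?addr0// => j jk; rewrite mxE (negbTE jk) mulr0.
  have -> : mxsub g g A = ((A *m X)^T *m X)^T.
    by rewrite !mulX; apply/matrixP => i k; rewrite !mxE.
  rewrite mxrank_tr mxrank_mul_inj; last first.
    move=> y yA yX; apply: trmx_inj; rewrite trmx0.
    have Ty : vertex_mx G alpha z *m y^T = 0.
      move: yA => /submxP[d ->]; rewrite trmx_mul trmxK !mulmxA TA.
      by rewrite !mul0mx.
    apply/colP => i; rewrite [RHS]mxE.
    rewrite -(enum_valK i).
    apply: (@right_kernel _ _ _ G alpha B B_boundary B_core cycles lambda
      (fun k => y^T (enum_rank k) 0)) => [u|v vB].
      have := congr1 (fun M => (row_of u *m M) 0 0) Ty.
      rewrite mulmx0 mulmxA mul_vertex_mx row_ofK [RHS]mxE => uTy.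
      rewrite -[RHS]uTy [RHS]mxE (reindex _ (onW_bij _ (enum_val_bij _))) /=.
      by apply: eq_bigr => k _; rewrite [row_of _ _ _]mxE enum_valK.
    have [k kE] := inB v vB; have /rowP/(_ k) := yX.
    by rewrite mulX !mxE kE.
  rewrite mxrank_tr mxrank_mul_inj// => u uA uX.
  have uT : u *m vertex_mx G alpha z = 0.
    by move: uA => /submxP[d ->]; rewrite -mulmxA AT mulmx0.
  rewrite -[u]unknown_ofK; apply/rowP => i; rewrite !mxE.
  apply: (unique_continuation B_boundary B_core cycles (kernel_row uT)) => v vB.
  have [k kE] := inB v vB; have /rowP/(_ k) := uX.
  by rewrite mulX !mxE kE.
have dimK := ker_has_dim G alpha z.
split; last by rewrite rAB.
rewrite (eigenvalue_has_dim dimK) -rAB (simple_pole_is_pole ah' HE) mxrank_eq0.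
by split=> [/eqP|/eqP].
Qed.
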